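(* Let $\Lambda(z)=z^{m+n}+\sum_{k=1}^{m+n}d_k z^{m+n-k}\in\mathbb{C}[z]$ and assume that all the coefficients $d_k$, $1\le k\le m+n$, are non-zero. Let $g_1,\ldots,g_{m+n}\in L_c[x_1^{\pm},\ldots,x_m^{\pm},y_1^{\pm},\ldots,y_n^{\pm}]$ be the polynomials $$g_{k}=\frac{q^m}{q^{m}-tq^{n}}\, e_{k}\Big(\frac{x_{1}}{q},\ldots,\frac{x_{m}}{q},y_{1},\ldots,y_{n}\Big)-\frac{tq^n}{q^{m}-tq^{n}}\,e_{k}\Big(x_{1},\ldots,x_{m},\frac{y_{1}}{q},\ldots,\frac{y_{n}}{q}\Big)-d_{k},$$ and let $\mathrm{Def}_{QQ}=V(\{g_1,\ldots,g_{m+n}\})\subset(L_c^{\times})^{m+n}$. Then the set of polynomials $g_1,\ldots,g_{m+n}$ forms a tropical basis of the tropical variety $\mathrm{trop}(\mathrm{Def}_{QQ})$, i.e. $$\mathrm{trop}(\mathrm{Def}_{QQ})=\bigcap_{k=1}^{m+n}\mathrm{trop}(V(g_k)),$$ and $\mathrm{trop}(\mathrm{Def}_{QQ})=\{(0,\ldots,0)\}$.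
   Context: $q\in\mathbb{C}^\times$ is fixed and $e_k$ denotes the $k$-th elementary symmetric polynomial in $m+n$ variables. $L_c$ is the field of convergent Puiseux series in $t$ with complex coefficients: series $\sum_{k\ge k_0}c_kt^{k/N}$ ($N\in\mathbb{Z}_{>0}$, $k_0\in\mathbb{Z}$) that converge in a neighborhood of $0$ (punctured at $0$ if the valuation is negative), with valuation $\nu$ equal to the lowest exponent with nonzero coefficient. It is algebraically closed with residue field $\mathbb{C}$. The equations $g_1=\cdots=g_{m+n}=0$ are equivalent to $Q_+(qz)Q_-(z)-tQ_+(z)Q_-(qz)=\Lambda(z)$ for $Q_+(z)=\prod_{i=1}^m(z+x_i)$ and $Q_-(z)=\frac{1}{q^m-tq^n}\prod_{j=1}^n(z+y_j)$. For a Laurent polynomial $f=\sum_{u}c_u x^u$ over $L_c$ in $M$ variables, $\mathrm{trop}(f)(w)=\min_u(\nu(c_u)+u\cdot w)$ for $w\in\mathbb{R}^M$, and $\mathrm{trop}(V(f))$ is the set of $w\in\mathbb{R}^M$ at which this minimum is achieved at least twice. For an ideal $I$ with variety $X=V(I)$ in the torus $(L_c^\times)^M$, $\mathrm{trop}(X)=\bigcap_{f\in I}\mathrm{trop}(V(f))$. A finite generating set $\mathcal{T}$ of $I$ is a tropical basis if $\mathrm{trop}(V(I))=\bigcap_{f\in\mathcal{T}}\mathrm{trop}(V(f))$; here $I$ is the ideal generated by $g_1,\ldots,g_{m+n}$. *)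

(* Defs.v *)
From HB Require Import structures.
From mathcomp Require Import all_boot all_order all_algebra.
From mathcomp Require Import finmap complex.
From mathcomp Require Import all_classical all_reals all_analysis.
(* The notations of monalg are incompatible with those of MathComp-Analysis. *)
From mathcomp Require Import -(notations) monalg.
From mathcomp Require Import ring lra zify.

Set Implicit Arguments.
Unset Strict Implicit.
Unset Printing Implicit Defensive.

Import Order.TTheory GRing.Theory Num.Theory.
Import numFieldNormedType.Exports.

Local Open Scope classical_set_scope.
Local Open Scope complex_scope.
Local Open Scope ring_scope.

Section Cauchy.
Variable (R : realType).
Local Notation C := (R[i]).
Implicit Types (u v w : nat -> C).

Let real_complexD (x y : R) : (x + y)%:C = x%:C + y%:C.
Proof. exact: (rmorphD (real_complex R)). Qed.
Let real_complexM (x y : R) : (x * y)%:C = x%:C * y%:C.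
Proof. exact: (rmorphM (real_complex R)). Qed.

Let normC_real (z : C) : exists2 a : R, 0 <= a & `|z| = a%:C.
Proof.
exists (Num.sqrt (complex.Re z ^+ 2 + complex.Im z ^+ 2)); first exact: sqrtr_ge0.
by rewrite normc_def.
Qed.

Definition cauchy u v : nat -> C :=
  fun n => \sum_(j < n.+1) u j * v (n - j)%N.

Definition geo u :=
  exists B r : R, [/\ 0 <= B, 1 <= r & forall i, `|u i| <= (B * r ^+ i)%:C].

Lemma cauchy_poly u v n N : (n < N)%N ->
  cauchy u v n = ((\poly_(i < N) u i) * (\poly_(i < N) v i))`_n.
Proof.
move=> nN; rewrite coefM; apply: eq_bigr => j _; rewrite !coef_poly.
have jn : (j <= n)%N by rewrite -ltnS.
by rewrite (leq_ltn_trans jn nN) (leq_ltn_trans (leq_subr _ _) nN).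
Qed.

Lemma cauchyC u v : cauchy u v = cauchy v u.
Proof. by apply/funext => n; rewrite !(@cauchy_poly _ _ n n.+1) // mulrC. Qed.

Lemma cauchyA u v w : cauchy u (cauchy v w) = cauchy (cauchy u v) w.
Proof.
apply/funext => n; rewrite !(@cauchy_poly _ _ n n.+1) //.
pose U := \poly_(i < n.+1) u i; pose V := \poly_(i < n.+1) v i.
pose W := \poly_(i < n.+1) w i.
transitivity ((U * (V * W))`_n).
  rewrite !coefM; apply: eq_bigr => j _; congr (_ * _).
  rewrite coef_poly ltnS leq_subr.
  by rewrite (@cauchy_poly _ _ _ n.+1) // ltnS leq_subr.
rewrite mulrA !coefM; apply: eq_bigr => j _; congr (_ * _).
rewrite coef_poly ltn_ord.
by rewrite (@cauchy_poly _ _ _ n.+1).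
Qed.

Lemma cauchyDl u v w :
  cauchy (fun i => u i + v i) w = (fun i => cauchy u w i + cauchy v w i).
Proof.
apply/funext => n; rewrite /cauchy -big_split.
by apply: eq_bigr => j _; rewrite /= mulrDl.
Qed.

Lemma cauchy1l u : cauchy (fun i => (i == 0)%:R) u = u.
Proof.
apply/funext => n; rewrite /cauchy big_ord_recl /= mul1r subn0.
by rewrite big1 ?addr0 // => j _; rewrite mul0r.
Qed.

Lemma geoW u B r : (forall i, `|u i| <= (B * r ^+ i)%:C) -> geo u.
Proof.
move=> h; exists `|B|, (Num.max 1 `|r|); split => //.
  by rewrite le_max lexx.
move=> i; apply: le_trans (h i) _; rewrite lecR.
apply: le_trans (ler_norm _) _; rewrite normrM normrX ler_wpM2l //.
by apply: lerXn2r; rewrite ?nnegrE ?le_max ?lexx ?ler01 ?orbT.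
Qed.

Lemma geoD u v : geo u -> geo v -> geo (fun i => u i + v i).
Proof.
case=> B [r [B0 r1 Hu]] [B' [r' [B'0 r'1 Hv]]].
apply: (@geoW _ (B + B') (r * r')) => i.
apply: le_trans (ler_normD _ _) _; apply: le_trans (lerD (Hu i) (Hv i)) _.
rewrite -real_complexD lecR exprMn.
have a1 : 1 <= r ^+ i by apply: exprn_ege1.
have a2 : 1 <= r' ^+ i by apply: exprn_ege1.
have h1 : B * r ^+ i <= B * (r ^+ i * r' ^+ i).
  by rewrite ler_wpM2l // ler_peMr // (le_trans _ a1).
have h2 : B' * r' ^+ i <= B' * (r ^+ i * r' ^+ i).
  by rewrite ler_wpM2l // ler_peMl // (le_trans _ a2).
by rewrite mulrDl lerD.
Qed.

Lemma geoN u : geo u -> geo (fun i => - u i).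
Proof.
case=> B [r [_ _ Hu]]; apply: (@geoW _ B r) => i.
by rewrite normrN.
Qed.

Lemma geo_cauchy u v : geo u -> geo v -> geo (cauchy u v).
Proof.
case=> B [r [B0 r1 Hu]] [B' [r' [B'0 r'1 Hv]]].
apply: (@geoW _ (B * B') (2 * (r * r'))) => n.
have H : forall j : 'I_n.+1,
    `|u j * v (n - j)%N| <= (B * B' * (r * r') ^+ n)%:C.
  move=> j; rewrite normrM; apply: le_trans (ler_pM _ _ (Hu _) (Hv _)) _ => //.
  rewrite -real_complexM lecR mulrACA ler_wpM2l ?mulr_ge0 // exprMn.
  have jn : (j <= n)%N by rewrite -ltnS.
  apply: ler_pM; rewrite ?exprn_ge0 ?(le_trans ler01) //.
    exact: ler_weXn2l.
  by apply: ler_weXn2l => //; exact: leq_subr.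
apply: le_trans (ler_norm_sum _ _ _) _.
apply: le_trans (ler_sum _ (fun j _ => H j)) _.
rewrite sumr_const card_ord -(rmorphMn (real_complex R)) lecR -mulr_natl.
rewrite mulrCA; apply: ler_wpM2l; first exact: mulr_ge0.
rewrite [leRHS]exprMn.
rewrite ler_wpM2r ?exprn_ge0 ?mulr_ge0 ?(le_trans ler01) //.
by rewrite -natrX ler_nat ltn_expl.
Qed.

Fixpoint invseq u (n : nat) : seq C :=
  if n is n'.+1 then
    let s := invseq u n' in
    rcons s (- (u 0)^-1 * \sum_(j < n'.+1) u j.+1 * s`_(n' - j))
  else [:: (u 0)^-1].

Definition cauchyV u n := (invseq u n)`_n.

Lemma size_invseq u n : size (invseq u n) = n.+1.
Proof. by elim: n => //= n IH; rewrite size_rcons IH. Qed.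

Lemma invseqE u n j : (j <= n)%N -> (invseq u n)`_j = cauchyV u j.
Proof.
elim: n => [|n IH]; first by rewrite leqn0 => /eqP ->.
rewrite leq_eqVlt => /orP[/eqP -> //|]; rewrite ltnS => jn.
by rewrite /= nth_rcons size_invseq ltnS jn IH.
Qed.

Lemma cauchyVS u n : cauchyV u n.+1 =
  - (u 0)^-1 * \sum_(j < n.+1) u j.+1 * cauchyV u (n - j)%N.
Proof.
rewrite /cauchyV /= nth_rcons size_invseq ltnn eqxx; congr (_ * _).
by apply: eq_bigr => j _; rewrite invseqE ?leq_subr.
Qed.

Lemma cauchyVr u : u 0 != 0 -> cauchy u (cauchyV u) = (fun i => (i == 0)%:R).
Proof.
move=> u0; apply/funext => -[|n]; rewrite /cauchy.
  by rewrite big_ord_recl big_ord0 addr0 /cauchyV /= mulfV.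
rewrite big_ord_recl /= subn0 cauchyVS mulrA mulrN mulfV // mulN1r.
by under [X in _ + X]eq_bigr => j _ do rewrite /bump /= subSS; rewrite addNr.
Qed.

Lemma geoV u : u 0 != 0 -> geo u -> geo (cauchyV u).
Proof.
move=> u0 [B [r [B0 r1 Hu]]].
have [c c0 cE] := normC_real (u 0)^-1.
pose K := r * (1 + c * B).
have K0 : 0 <= 1 + c * B by rewrite addr_ge0 ?mulr_ge0.
apply: (@geoW _ c K) => n; elim/ltn_ind: n => -[|n] IH.
  by rewrite /cauchyV /= cE mulr1.
rewrite cauchyVS normrM normrN cE real_complexM; apply: ler_wpM2l.
  by rewrite ler0c.
apply: le_trans (ler_norm_sum _ _ _) _.
have H : forall j : 'I_n.+1, `|u j.+1 * cauchyV u (n - j)%N| <=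
    (r ^+ n.+1 * (c * B * (1 + c * B) ^+ (n - j)))%:C.
  move=> j; rewrite normrM.
  have jn : (j <= n)%N by rewrite -ltnS.
  have nj : (n - j < n.+1)%N by rewrite ltnS leq_subr.
  apply: le_trans (ler_pM _ _ (Hu _) (IH _ nj)) _ => //.
  rewrite -real_complexM lecR /K exprMn.
  have -> : r ^+ n.+1 = r ^+ j.+1 * r ^+ (n - j).
    by rewrite -exprD addSn subnKC.
  by rewrite le_eqVlt; apply/orP; left; apply/eqP; ring.
apply: le_trans (ler_sum _ (fun j _ => H j)) _.
rewrite -(rmorph_sum (real_complex R)) lecR -mulr_sumr /K exprMn.
rewrite ler_wpM2l ?exprn_ge0 ?(le_trans ler01) // -mulr_sumr.
have -> : \sum_(j < n.+1) (1 + c * B) ^+ (n - j) = \sum_(j < n.+1) (1 + c * B) ^+ j.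
  rewrite (reindex_inj rev_ord_inj) /=; apply: eq_bigr => j _.
  by rewrite subSS subKn // -ltnS.
have := subrX1 (1 + c * B) n.+1; rewrite [1 + c * B - 1]addrC addKr => <-.
by rewrite gerBl ler01.
Qed.

Lemma cvg_geo u (k : int) : geo u ->
  exists2 e : R, 0 < e & forall s : C, 0 < `|s| -> `|s| < e%:C ->
    cvgn (series (fun i : nat => u i * s ^ (k + i%:Z) : C^o)).
Proof.
case=> B [r [B0 r1 Hu]].
have r0 : 0 < r by apply: lt_le_trans r1.
exists (r^-1 / 2); first by rewrite divr_gt0 ?invr_gt0.
move=> s s0 se.
have s1 : s != 0 by rewrite -normr_gt0.
pose f i : C := u i * s ^ (k + i%:Z).
have [a a0 aE] := normC_real (s ^ k).
have Hf i : `|f i| <= (geometric (B * a) (2^-1) i)%:C.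
  rewrite /f expfzDr // !normrM aE /geometric.
  have h : `|s ^ i%:Z| <= ((r^-1 / 2) ^+ i)%:C.
    rewrite -exprnP normrX [leRHS](rmorphXn (real_complex R)).
    apply: lerXn2r; rewrite ?nnegrE //.
      by rewrite ler0c divr_ge0 ?invr_ge0 ?(ltW r0).
    exact: ltW.
  have h2 : `|u i| * (a%:C * `|s ^ i%:Z|) <= (B * r ^+ i)%:C * (a%:C * ((r^-1 / 2) ^+ i)%:C).
    have a0' : 0 <= a%:C :> C by rewrite ler0c.
    apply: ler_pM => //; first by rewrite mulr_ge0.
    exact: ler_wpM2l.
  apply: le_trans h2 _; rewrite -!real_complexM lecR exprMn exprVn.
  rewrite le_eqVlt; apply/orP; left; apply/eqP => /=.
  by rewrite exprVn; field; rewrite !expf_neq0 ?gt_eqF.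
have cvR (g : nat -> R) : (forall i, `|g i|%:C <= `|f i|) -> cvgn (series g).
  move=> gf; apply: normed_cvg; apply: (@series_le_cvg _ _ (geometric (B * a) (2^-1))).
  - by move=> i; exact: normr_ge0.
  - by move=> i; rewrite /geometric /= !mulr_ge0 ?exprn_ge0 ?invr_ge0.
  - by move=> i; rewrite -lecR; apply: le_trans (gf i) (Hf i).
  - apply: is_cvg_geometric_series; rewrite ger0_norm ?invr_ge0 //; lra.
have c1 := cvR (fun i => complex.Re (f i)) (fun i => normc_ge_Re _).
have c2 : cvgn (series (fun i => complex.Im (f i))).
  apply: cvR => i; rewrite normc_def lecR -sqrtr_sqr.
  by rewrite ler_wsqrtr // lerDr sqr_ge0.
apply/cvg_ex; exists (limn (series (fun i => complex.Re (f i))) +i*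
                      limn (series (fun i => complex.Im (f i)))).
apply/cvgrPdist_lt => e e0.
have eR : e \is Num.real by rewrite gtr0_real.
have [e' e'0 eE] := normC_real e; rewrite gtr0_norm // in eE.
have e'gt : 0 < e' by rewrite -ltcR -eE.
have e2 : 0 < e' / 2 by rewrite divr_gt0.
move/cvgrPdist_lt: c1 => /(_ _ e2) c1.
move/cvgrPdist_lt: c2 => /(_ _ e2) c2.
have sE n : series (fun i => f i) n = series (fun i => complex.Re (f i)) n +i*
    series (fun i => complex.Im (f i)) n.
  elim: n => [|n IH]; first by rewrite /series /= !big_geq.
  by rewrite !seriesSr IH; case: (f n) => a1 b1.
near=> n.
have h1 : `|limn (series (fun i => complex.Re (f i))) - series (fun i => complex.Re (f i)) n| < e' / 2 by near: n.
have h2 : `|limn (series (fun i => complex.Im (f i))) - series (fun i => complex.Im (f i)) n| < e' / 2 by near: n.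
rewrite sE eE; move: h1 h2; set x1 := limn _; set x2 := limn _.
set y1 := series _ _; set y2 := series _ _ => h1 h2.
have -> : (x1 +i* x2) - (y1 +i* y2) = (x1 - y1) +i* (x2 - y2) by [].
rewrite normc_def ltcR -[ltRHS]ger0_norm ?(ltW e'gt) // -sqrtr_sqr.
rewrite ltr_sqrt ?exprn_gt0 //=.
have := ltr_pM (normr_ge0 _) (normr_ge0 _) h1 h1.
have := ltr_pM (normr_ge0 _) (normr_ge0 _) h2 h2.
rewrite -!expr2 !real_normK ?num_real //; move: e'gt; nra.
Unshelve. all: by end_near.
Qed.
End Cauchy.

Section PuiseuxSeries.
Variable (R : realType).
Local Notation C := (R[i]).
Implicit Types (c : rat -> C) (u v : nat -> C) (N : nat) (k l : int).

Definition pexp N k (i : nat) : rat := (k + i%:Z)%:~R / N%:R.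

(* The series sum_r c(r) t^r has all its exponents in k/N, (k+1)/N, ..., and,
   with s = t^(1/N), converges on a punctured disc around 0. *)
Definition convergent_puiseux_at N k c :=
  (forall r, c r != 0 -> exists i, r = pexp N k i) /\
  (exists2 e : R, 0 < e & forall s : C, 0 < `|s| -> `|s| < e%:C ->
    cvgn (series (fun i : nat => c (pexp N k i) * s ^ (k + i%:Z) : C^o))).

Definition convergent_puiseux c :=
  exists N k, (0 < N)%N /\ convergent_puiseux_at N k c.

Record puiseux := Puiseux {
  pcoef : rat -> C;
  _ : `[< convergent_puiseux pcoef >]
}.

HB.instance Definition _ := [isSub for pcoef].
HB.instance Definition _ := [Choice of puiseux by <:].

Lemma puiseuxP (f g : puiseux) : pcoef f =1 pcoef g -> f = g.
Proof. by move=> fg; apply: val_inj; apply/funext. Qed.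

Lemma pcoefP (f : puiseux) : convergent_puiseux (pcoef f).
Proof. by case: f => c /= /asboolP. Qed.

(* Series presented by a sequence of coefficients in t^(1/N). *)
Definition pseries N k u : rat -> C := fun r =>
  let x := r * N%:R - k%:~R in
  if x \is a Num.nat then u (Num.truncn x) else 0.

Lemma pexpK N k i : (0 < N)%N -> pexp N k i * N%:R - k%:~R = i%:R.
Proof.
move=> N0; rewrite /pexp divfK ?pnatr_eq0 -?lt0n //.
by rewrite rmorphD /= addrAC subrr add0r.
Qed.

Lemma pexp_inj N k : (0 < N)%N -> injective (pexp N k).
Proof.
move=> N0 i j /(congr1 (fun x => x * N%:R - k%:~R)); rewrite !pexpK // => /eqP.
by rewrite eqr_nat => /eqP.
Qed.

Lemma pseriesE N k u i : (0 < N)%N -> pseries N k u (pexp N k i) = u i.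
Proof. by move=> N0; rewrite /pseries pexpK // natr_nat natrK. Qed.

Variant pexp_spec N k : rat -> Type :=
| PexpIn i : pexp_spec N k (pexp N k i)
| PexpOut r of (forall i, r != pexp N k i) & (forall u, pseries N k u r = 0) :
    pexp_spec N k r.

Lemma pexpP N k r : (0 < N)%N -> pexp_spec N k r.
Proof.
move=> N0; case: (boolP (r * N%:R - k%:~R \is a Num.nat)) => [/truncnK h|h].
  have -> : r = pexp N k (Num.truncn (r * N%:R - k%:~R)).
    rewrite /pexp rmorphD /= -pmulrn h addrCA subrr addr0 mulfK //.
    by rewrite pnatr_eq0 -lt0n.
  by constructor.
constructor=> [i|u]; last by rewrite /pseries (negbTE h).
by apply: contra h => /eqP ->; rewrite pexpK // natr_nat.
Qed.

Lemma pseries_inv N k u : (0 < N)%N -> geo u -> convergent_puiseux (pseries N k u).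
Proof.
move=> N0 gu; exists N, k; split => //; split.
  by move=> r; case: (pexpP k r N0) => [i _|r' _ ->]; [exists i | rewrite eqxx].
have [e e0 H] := cvg_geo k gu; exists e; first exact: e0.
move=> s s0 se.
have -> : (fun i : nat => pseries N k u (pexp N k i) * s ^ (k + i%:Z) : C^o) =
    (fun i => u i * s ^ (k + i%:Z)).
  by apply/funext => i; rewrite pseriesE.
exact: H.
Qed.

Definition mkp N k u (N0 : (0 < N)%N) (gu : geo u) : puiseux :=
  Puiseux (asboolT (pseries_inv k N0 gu)).

Lemma geo_puiseux N k c : (0 < N)%N -> convergent_puiseux_at N k c ->
  exists2 u, geo u & c = pseries N k u.
Proof.
move=> N0 [Hs [e e0 Hc]]; exists (fun i => c (pexp N k i)); last first.
  apply/funext => r; case: (pexpP k r N0) => [i|{}r Hr ->].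
    by rewrite pseriesE.
  by apply/eqP; apply: contraT => /Hs [i ri]; have := Hr i; rewrite ri eqxx.
pose s : C := (e / 2)%:C.
have e2 : 0 < e / 2 by rewrite divr_gt0.
have sE : `|s| = s by rewrite ger0_norm // ler0c ltW.
have s0 : 0 < s by rewrite ltcR.
have := Hc s; rewrite sE s0 => /(_ isT).
rewrite ltcR ltr_pdivrMr // mulr_natr mulr2n ltrDl e0 => /(_ isT).
move/cvg_series_cvg_0 => h; have := cvgP _ h.
move/cvg_seq_bounded => [B [BR HB]].
have {}HB i : `|c (pexp N k i) * s ^ (k + i%:Z)| <= B + 1.
  by apply: (HB (B + 1)) => //; rewrite ltrDl.
have B0 : 0 <= B + 1 by apply: le_trans (HB 0%N).
have [B' B'0 BE] : exists2 B' : R, 0 <= B' & B + 1 = B'%:C.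
  exists (complex.Re (B + 1)); move: B0; rewrite lecE /= => /andP[/eqP h1 h2] //.
  by apply/eqP; rewrite eq_complex /= -h1 !eqxx.
have [a a0 aE] : exists2 a : R, 0 <= a & `|s ^ (- k)| = a%:C.
  exists (Num.sqrt (complex.Re (s ^ (- k)) ^+ 2 + complex.Im (s ^ (- k)) ^+ 2)).
    exact: sqrtr_ge0.
  by rewrite normc_def.
apply: (@geoW _ _ (B' * a) ((e / 2)^-1)) => i.
have sn : s != 0 by rewrite gt_eqF.
have -> : c (pexp N k i) =
    (c (pexp N k i) * s ^ (k + i%:Z)) * (s ^ (- k) * s ^ (- i%:Z)).
  by rewrite -mulrA -!expfzDr // [X in s ^ X](_ : _ = 0) ?expr0z ?mulr1 //; lia.
rewrite normrM [X in _ * X]normrM aE.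
have -> : `|s ^ (- i%:Z)| = ((e / 2)^-1 ^+ i)%:C.
  rewrite -exprnN -exprVn normrX normfV sE.
  by rewrite (rmorphXn (real_complex R)) (fmorphV (real_complex R)).
rewrite !(rmorphM (real_complex R)) /= mulrA; apply: ler_wpM2r.
  by rewrite ler0c exprn_ge0 // invr_ge0 ltW.
by apply: ler_wpM2r; rewrite ?ler0c // -BE.
Qed.


Definition presented (f : puiseux) N k :=
  exists2 u, geo u & pcoef f = pseries N k u.

Lemma presentedP f : exists N k, (0 < N)%N /\ presented f N k.
Proof.
have [N [k [N0 H]]] := pcoefP f; exists N, k; split => //.
exact: geo_puiseux.
Qed.

Lemma pexp_refine N k m (k' : int) i i' : (0 < N)%N -> (0 < m)%N ->
  (pexp N k i == pexp (N * m)%N k' i') = ((k + i%:Z) * m%:Z == k' + i'%:Z).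
Proof.
move=> N0 m0; rewrite /pexp natrM.
have N0' : N%:R != 0 :> rat by rewrite pnatr_eq0 -lt0n.
have m0' : m%:R != 0 :> rat by rewrite pnatr_eq0 -lt0n.
rewrite invfM mulrA -(inj_eq (mulIf m0')) mulfVK // mulrAC.
rewrite (inj_eq (mulIf (invr_neq0 N0'))) pmulrn -intrM.
by rewrite (inj_eq (@intr_inj rat)).
Qed.

Lemma presentedW f N k m k' : (0 < N)%N -> (0 < m)%N -> presented f N k ->
  k' <= k * m%:Z -> presented f (N * m)%N k'.
Proof.
move=> N0 m0 [u [B [r [B0 r1 Hu]]] fE] kk'; rewrite /presented fE.
have Nm0 : (0 < N * m)%N by rewrite muln_gt0 N0.
exists (fun i => pseries N k u (pexp (N * m)%N k' i)); last first.
  apply/funext => x; case: (pexpP k' x Nm0) => [i|{}x Hx ->].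
    by rewrite pseriesE.
  case: (pexpP k x N0) Hx => [i|//].
  have [j jE] : exists j : nat, (k + i%:Z) * m%:Z = k' + j%:Z.
    have h : 0 <= (k + i%:Z) * m%:Z - k'.
      by rewrite subr_ge0 (le_trans kk') // ler_wpM2r // lerDl.
    by exists (absz ((k + i%:Z) * m%:Z - k')%R); rewrite gez0_abs // [RHS]addrC subrK.
  by move/(_ j); rewrite pexp_refine // jE eqxx.
apply: (@geoW _ _ B r) => i; move: (pexpP k (pexp (N * m)%N k' i) N0).
move xE : (pexp (N * m)%N k' i) => x xS; case: xS xE => [j|{}x _ -> _]; last first.
  by rewrite normr0 ler0c mulr_ge0 // exprn_ge0 // (le_trans ler01).
move/esym/eqP; rewrite pexp_refine // => /eqP jE.
rewrite pseriesE //; apply: le_trans (Hu j) _.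
rewrite lecR ler_wpM2l // ler_weXn2l //.
have : j%:Z * m%:Z <= i%:Z by move: jE kk'; rewrite mulrDl; lia.
by move: m0; nia.
Qed.

Lemma presented3 f g h : exists N k,
  [/\ (0 < N)%N, presented f N k, presented g N k & presented h N k].
Proof.
have [N1 [k1 [N10 H1]]] := presentedP f.
have [N2 [k2 [N20 H2]]] := presentedP g.
have [N3 [k3 [N30 H3]]] := presentedP h.
have N12 : (0 < N1 * N2)%N by rewrite muln_gt0 N10.
have N23 : (0 < N2 * N3)%N by rewrite muln_gt0 N20.
have N13 : (0 < N1 * N3)%N by rewrite muln_gt0 N10.
pose k := Num.min (k1 * (N2 * N3)%N%:Z)
  (Num.min (k2 * (N1 * N3)%N%:Z) (k3 * (N1 * N2)%N%:Z)).
exists (N1 * (N2 * N3))%N, k; split.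
- by rewrite muln_gt0 N10.
- by apply: presentedW H1 _ => //; rewrite ge_min lexx.
- rewrite mulnCA; apply: presentedW H2 _ => //.
  by rewrite !ge_min lexx !orbT.
- rewrite mulnA mulnC; apply: presentedW H3 _ => //.
  by rewrite !ge_min lexx !orbT.
Qed.

Lemma presented_inv N k c : (0 < N)%N -> (exists2 u, geo u & c = pseries N k u) ->
  convergent_puiseux c.
Proof. by move=> N0 [u gu ->]; exact: pseries_inv. Qed.

(* Convolution of exponents; the sum is finite for Puiseux series because their
   exponents are bounded below and have a common denominator. *)
Definition pconv c c' : rat -> C := fun r => \sum_(a \in [set: rat]) c a * c' (r - a).

Lemma pconv_pseries N k l u v : (0 < N)%N ->
  pconv (pseries N k u) (pseries N l v) = pseries N (k + l) (cauchy u v).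
Proof.
move=> N0; apply/funext => r; rewrite /pconv.
have pexpD i j : pexp N (k + l) (i + j) = pexp N k i + pexp N l j.
  by rewrite /pexp -mulrDl -intrD PoszD addrACA.
case: (pexpP (k + l) r N0) => [n|{}r Hr ->]; last first.
  rewrite fsbig1 // => a _.
  case: (pexpP k a N0) => [i|{}a _ ->]; last by rewrite mul0r.
  move rE : (r - _) => b; case: (pexpP l b N0) rE => [j|{}b _ -> _]; last first.
    by rewrite mulr0.
  move=> rE; have := Hr (i + j)%N.
  by rewrite pexpD -rE addrC subrK eqxx.
rewrite pseriesE // (fsbigE [seq pexp N k i | i <- iota 0 n.+1]) //; last first.
- move=> a _; case: (pexpP k a N0) => [i ni|{}a _ ->]; last by rewrite mul0r.
  have {}ni : (n < i)%N.
    rewrite ltnNge; apply: contra ni => le; apply/mapP; exists i => //.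
    by rewrite mem_iota.
  move rE : (_ - _) => b; case: (pexpP l b N0) rE => [j|{}b _ -> _]; last first.
    by rewrite mulr0.
  move/eqP; rewrite subr_eq [X in _ == X]addrC -pexpD => /eqP /(pexp_inj N0) nE.
  by move: ni; rewrite nE ltnNge leq_addr.
- by rewrite map_inj_uniq ?iota_uniq //; exact: pexp_inj.
under eq_bigl do rewrite in_setT.
rewrite big_map -[iota 0 n.+1]/(index_iota 0 n.+1) big_mkord /cauchy.
apply: eq_bigr => j _; rewrite pseriesE //; congr (_ * _).
have jn : (j <= n)%N by rewrite -ltnS.
by rewrite -{1}(subnKC jn) pexpD addrC addKr pseriesE.
Qed.

Lemma pcst_subproof (a : C) (r : rat) :
  convergent_puiseux (fun x => if x == r then a else 0).
Proof.
have N0 : (0 < `|denq r|)%N by rewrite absz_gt0 denq_neq0.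
apply: (@presented_inv `|denq r| (numq r) _ N0).
exists (fun i => if i == 0%N then a else 0).
  apply: (@geoW _ _ (Num.sqrt (complex.Re a ^+ 2 + complex.Im a ^+ 2)) 1) => i.
   rewrite expr1n mulr1 -normc_def; case: ifP => _ //.
  by rewrite normr0.
have rE : pexp `|denq r| (numq r) 0 = r.
  rewrite /pexp addr0 -[RHS]divq_num_den pmulrn gez0_abs //.
apply/funext => x; case: (pexpP (numq r) x N0) => [i|{}x Hx ->].
  by rewrite pseriesE // -[X in _ == X]rE (inj_eq (pexp_inj N0)).
by case: eqP => // xr; have := Hx 0%N; rewrite rE xr eqxx.
Qed.

(* a t^r *)
Definition pmonom (a : C) (r : rat) : puiseux := Puiseux (asboolT (pcst_subproof a r)).

End PuiseuxSeries.

Section PuiseuxField.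
Variable (R : realType).
Local Notation C := (R[i]).
Local Notation puiseux := (puiseux R).
Implicit Types (f g h : puiseux).

Lemma pseries0 N k (r : rat) : pseries N k (fun=> 0 : C) r = 0.
Proof. by rewrite /pseries if_same. Qed.

Lemma pseriesD N k (u v : nat -> C) (r : rat) :
  pseries N k u r + pseries N k v r = pseries N k (fun i => u i + v i) r.
Proof. by rewrite /pseries; case: ifP; rewrite ?addr0. Qed.

Lemma pseriesN N k (u : nat -> C) (r : rat) :
  - pseries N k u r = pseries N k (fun i => - u i) r.
Proof. by rewrite /pseries; case: ifP; rewrite ?oppr0. Qed.

Fact padd_subproof f g : convergent_puiseux (fun r => pcoef f r + pcoef g r).
Proof.
have [N [k [N0 [u gu ->] [v gv ->] _]]] := presented3 f g g.
apply: (presented_inv N0); exists (fun i => u i + v i); first exact: geoD.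
by apply/funext => r; rewrite pseriesD.
Qed.
Definition padd f g := Puiseux (asboolT (padd_subproof f g)).

Fact popp_subproof f : convergent_puiseux (fun r => - pcoef f r).
Proof.
have [N [k [N0 [u gu ->]]]] := presentedP f.
apply: (presented_inv N0); exists (fun i => - u i); first exact: geoN.
by apply/funext => r; rewrite pseriesN.
Qed.
Definition popp f := Puiseux (asboolT (popp_subproof f)).

Fact pmul_subproof f g : convergent_puiseux (pconv (pcoef f) (pcoef g)).
Proof.
have [N [k [N0 [u gu ->] [v gv ->] _]]] := presented3 f g g.
rewrite pconv_pseries //; apply: (presented_inv N0).
by exists (cauchy u v); first exact: geo_cauchy.
Qed.
Definition pmul f g := Puiseux (asboolT (pmul_subproof f g)).

Fact paddA : associative padd.
Proof. by move=> f g h; apply: puiseuxP => r; rewrite /= addrA. Qed.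
Fact paddC : commutative padd.
Proof. by move=> f g; apply: puiseuxP => r; rewrite /= addrC. Qed.
Fact padd0 : left_id (pmonom 0 0) padd.
Proof. by move=> f; apply: puiseuxP => r; rewrite /= if_same add0r. Qed.
Fact paddN : left_inverse (pmonom 0 0) popp padd.
Proof. by move=> f; apply: puiseuxP => r; rewrite /= if_same addNr. Qed.

HB.instance Definition _ := GRing.isZmodule.Build puiseux paddA paddC padd0 paddN.

Fact pmulA : associative pmul.
Proof.
move=> f g h; apply: puiseuxP => r /=.
have [N [k [N0 [u gu ->] [v gv ->] [w gw ->]]]] := presented3 f g h.
by rewrite !pconv_pseries // cauchyA addrA.
Qed.
Fact pmulC : commutative pmul.
Proof.
move=> f g; apply: puiseuxP => r /=.
have [N [k [N0 [u gu ->] [v gv ->] _]]] := presented3 f g g.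
by rewrite !pconv_pseries // cauchyC.
Qed.

Lemma pcoef1 N : (0 < N)%N ->
  pcoef (pmonom (1 : C) 0) = pseries N 0 (fun i => (i == 0%N)%:R).
Proof.
move=> N0; apply/funext => r /=.
have p0 : pexp N 0 0 = 0 by rewrite /pexp mul0r.
case: (pexpP R 0 r N0) => [i|{}r Hr ->].
  by rewrite pseriesE // -[X in _ == X]p0 (inj_eq (pexp_inj N0)); case: eqP.
by case: eqP => // r0; have := Hr 0%N; rewrite p0 r0 eqxx.
Qed.

Fact pmul1 : left_id (pmonom 1 0) pmul.
Proof.
move=> f; have [N [k [N0 [u gu fE]]]] := presentedP f.
apply: puiseuxP => r.
change (pconv (pcoef (pmonom 1 0)) (pcoef f) r = pcoef f r).
rewrite (pcoef1 N0) fE pconv_pseries //.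
by rewrite cauchy1l add0r.
Qed.
Fact pmulDl : left_distributive pmul padd.
Proof.
move=> f g h; apply: puiseuxP => r /=.
have [N [k [N0 [u gu ->] [v gv ->] [w gw ->]]]] := presented3 f g h.
under [X in pconv X _]eq_fun do rewrite pseriesD.
by rewrite !pconv_pseries // cauchyDl pseriesD.
Qed.
Fact pone_neq0 : pmonom 1 0 != 0 :> puiseux.
Proof.
apply/eqP => /(congr1 (fun f => pcoef f 0)).
change ((if (0 : rat) == 0 then 1 else 0) = (if (0 : rat) == 0 then 0 else 0) :> C -> False).
by rewrite eqxx => /eqP; rewrite oner_eq0.
Qed.

HB.instance Definition _ := GRing.Zmodule_isComNzRing.Build puiseux
  pmulA pmulC pmul1 pmulDl pone_neq0.

Lemma pcoef0 r : pcoef (0 : puiseux) r = 0. Proof. exact: if_same. Qed.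

Lemma presented_lead f : f != 0 -> exists N k u,
  [/\ (0 < N)%N, geo u, u 0%N != 0 & pcoef f = pseries N k u].
Proof.
move=> f0; have [N [k [N0 [u [B [r [B0 r1 Hu]]] fE]]]] := presentedP f.
have ex : exists i, u i != 0.
  apply: contrapT => nex; case/eqP: f0; apply: puiseuxP => x.
  rewrite pcoef0 fE; case: (pexpP R k x N0) => [i|{}x _ ->] //.
  by rewrite pseriesE //; apply/eqP; apply: contraT => ui; case: nex; exists i.
pose i0 := ex_minn ex.
have [ui0 min0] : u i0 != 0 /\ forall i, u i != 0 -> (i0 <= i)%N.
  by rewrite /i0; case: ex_minnP.
have pE i : pexp N (k + i0%:Z) i = pexp N k (i0 + i).
  by rewrite /pexp PoszD addrA.
exists N, (k + i0%:Z), (fun i => u (i0 + i)%N); split => //.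
- apply: (@geoW _ _ (B * r ^+ i0) r) => i.
  by rewrite -mulrA -exprD; exact: Hu.
- by rewrite addn0.
- rewrite fE; apply/funext => x; case: (pexpP R (k + i0%:Z) x N0) => [i|{}x Hx ->].
    by rewrite [RHS]pseriesE // pE pseriesE.
  case: (pexpP R k x N0) Hx => [i Hi|//]; rewrite pseriesE //.
  apply/eqP; apply: contraT => ui; have := Hi (i - i0)%N.
  by rewrite pE subnKC ?eqxx // min0.
Qed.

Lemma pinv_ex f : f != 0 -> exists g, g * f = 1.
Proof.
move=> /presented_lead [N [k [u [N0 gu u0 fE]]]].
exists (mkp (- k) N0 (geoV u0 gu)); rewrite mulrC; apply: puiseuxP => r.
transitivity (pconv (pcoef f) (pseries N (- k) (cauchyV u)) r) => //.
rewrite fE pconv_pseries // cauchyVr // subrr -(pcoef1 N0) //.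
Qed.

Definition pinv f : puiseux := xget 0 [set g | g * f = 1].

Fact pmulVf f : f != 0 -> pinv f * f = 1.
Proof. by move=> /pinv_ex [g gf]; rewrite /pinv; case: xgetP => [_ ->|/(_ g)]. Qed.
Fact pinv0 : pinv 0 = 0.
Proof.
rewrite /pinv; case: xgetP => // g ->.
by rewrite /= mulr0 => /esym/eqP; rewrite oner_eq0.
Qed.

HB.instance Definition _ := GRing.ComNzRing_isField.Build puiseux pmulVf pinv0.

(* The lowest exponent with nonzero coefficient; +oo for the zero series. *)
Definition pval f : \bar R :=
  ereal_inf [set (ratr r)%:E | r in [set r | pcoef f r != 0]].

Lemma pvalE f : f != 0 -> exists r,
  [/\ pcoef f r != 0, pval f = (ratr r)%:E & forall s, pcoef f s != 0 -> r <= s].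
Proof.
move=> /presented_lead [N [k [u [N0 gu u0 fE]]]].
have c0 : pcoef f (pexp N k 0) != 0 by rewrite fE pseriesE.
have le s : pcoef f s != 0 -> pexp N k 0 <= s.
  rewrite fE; case: (pexpP R k s N0) => [i _|{}s _ ->]; last by rewrite eqxx.
  rewrite /pexp ler_pM2r ?invr_gt0 ?ltr0n // ler_int addr0 lerDl //.
exists (pexp N k 0); split => //; apply/eqP; rewrite eq_le; apply/andP; split.
  by apply: ereal_inf_lbound; exists (pexp N k 0).
by apply: le_ereal_inf_tmp => _ [s /le h <-]; rewrite lee_fin ler_rat.
Qed.

End PuiseuxField.

Section LaurentPolynomials.
Variables (L : comNzRingType) (M : nat).

(* Laurent polynomials in M variables: finitely supported families of
   coefficients indexed by the exponents u in Z^M. *)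
Definition laurent : Type := malg 'rV[int]_M L.

HB.instance Definition _ := GRing.Lmodule.copy laurent (malg 'rV[int]_M L).

Implicit Types (f g h : laurent) (u v : 'rV[int]_M) (c : L).

Definition lterm u c : laurent := mkmalgU u%R c.

Definition lmul f g : laurent :=
  \sum_(u <- msupp f) \sum_(v <- msupp g) lterm (u + v) (mcoeff u f * mcoeff v g).

Let lterm0 u : lterm u 0 = 0. Proof. exact: monalgU0. Qed.
Let ltermD u c c' : lterm u (c + c') = lterm u c + lterm u c'.
Proof. exact: monalgUD. Qed.

Lemma laurentE f : f = \sum_(u <- msupp f) lterm u (mcoeff u f).
Proof. exact: monalgE. Qed.

Lemma lmulw (d1 d2 : {fset 'rV[int]_M}) f g :
  fsubset (msupp f) d1 -> fsubset (msupp g) d2 ->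
  lmul f g = \sum_(u <- d1) \sum_(v <- d2) lterm (u + v) (mcoeff u f * mcoeff v g).
Proof.
move=> le_d1 le_d2; rewrite /lmul (big_fset_incl _ le_d1) /=.
  apply/eq_bigr=> u _; apply/big_fset_incl => // v _ /mcoeff_outdom ->.
  by rewrite mulr0 lterm0.
move=> u _ /mcoeff_outdom fu.
by rewrite big1 => // v _; rewrite fu mul0r lterm0.
Qed.

Lemma lmulC : commutative lmul.
Proof.
move=> f g; rewrite /lmul exchange_big.
by apply: eq_bigr => u _; apply: eq_bigr => v _; rewrite addrC mulrC.
Qed.

Lemma lmulDl : left_distributive lmul +%R.
Proof.
move=> f g h.
rewrite (@lmulw _ _ (f + g) h (msuppD_le f g) (fsubset_refl _)).
rewrite (@lmulw _ _ f h (fsubsetUl _ (msupp g)) (fsubset_refl _)).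
rewrite (@lmulw _ _ g h (fsubsetUr (msupp f) _) (fsubset_refl _)).
rewrite -big_split /=; apply/eq_bigr=> u _.
rewrite -big_split /=; apply/eq_bigr=> v _.
by rewrite mcoeffD mulrDl ltermD.
Qed.

Lemma lmul0 f : lmul 0 f = 0.
Proof. by rewrite /lmul msupp0 big_seq_fset0. Qed.

Lemma lmulUU u v c c' : lmul (lterm u c) (lterm v c') = lterm (u + v) (c * c').
Proof.
rewrite (lmulw (@msuppU_le _ _ u c) (@msuppU_le _ _ v c')).
by rewrite !big_seq_fset1 !mcoeffUU.
Qed.

Lemma lmul_suml (I : Type) (r : seq I) (F : I -> laurent) g :
  lmul (\sum_(i <- r) F i) g = \sum_(i <- r) lmul (F i) g.
Proof.
by rewrite (big_morph (lmul^~ g) (fun _ _ => lmulDl _ _ _) (lmul0 g)).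
Qed.

Lemma lmul_sumr (I : Type) (r : seq I) (F : I -> laurent) g :
  lmul g (\sum_(i <- r) F i) = \sum_(i <- r) lmul g (F i).
Proof. by rewrite lmulC lmul_suml; apply: eq_bigr => i _; rewrite lmulC. Qed.

Lemma lmulA : associative lmul.
Proof.
move=> f g h; rewrite (laurentE f) (laurentE g) (laurentE h).
rewrite [LHS]lmul_suml [X in _ = lmul X _]lmul_suml [RHS]lmul_suml.
apply: eq_bigr => u _.
rewrite [X in lmul _ X = _]lmul_suml [LHS]lmul_sumr.
rewrite [X in _ = lmul X _]lmul_sumr [RHS]lmul_suml.
apply: eq_bigr => v _.
rewrite lmulUU [X in lmul _ X = _]lmul_sumr [LHS]lmul_sumr [RHS]lmul_sumr.
by apply: eq_bigr => w _; rewrite !lmulUU mulrA addrA.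
Qed.

Lemma lmul1 : left_id (lterm 0 1) lmul.
Proof.
move=> f; rewrite [f]laurentE lmul_sumr.
by apply: eq_bigr => u _; rewrite lmulUU add0r mul1r.
Qed.

Lemma lone_neq0 : lterm 0 1 != 0.
Proof.
apply/eqP => /(congr1 (mcoeff 0%R)) /eqP.
by rewrite mcoeffUU mcoeff0 oner_eq0.
Qed.

HB.instance Definition _ := GRing.Zmodule_isComNzRing.Build laurent
  lmulA lmulC lmul1 lmulDl lone_neq0.

Fact lscaleAl c f g : c *: (f * g) = (c *: f) * g.
Proof.
have sE k : c *: k = lterm 0 c * k :> laurent.
  change (fgscale c k = lmul (lterm 0 c) k).
  rewrite /fgscale [in RHS](laurentE k) lmul_sumr.
  by apply: eq_bigr => u _; rewrite lmulUU add0r.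
by rewrite !sE mulrA.
Qed.
HB.instance Definition _ := GRing.Lmodule_isLalgebra.Build L laurent lscaleAl.
HB.instance Definition _ := GRing.Lalgebra_isComAlgebra.Build L laurent.

Definition lvar (i : 'I_M) : laurent := lterm (delta_mx 0 i) 1.

End LaurentPolynomials.

Notation "{ 'laurent' L [ M ] }" := (laurent L M)
  (at level 0, L, M at level 2, format "{ 'laurent'  L [ M ] }") : type_scope.

(* The k-th elementary symmetric polynomial evaluated at z_1, ..., z_M. *)
Definition esym (A : comNzRingType) (M k : nat) (z : 'I_M -> A) : A :=
  \sum_(S : {set 'I_M} | #|S| == k) \prod_(i in S) z i.

Definition ideal_generated (A : comNzRingType) (T : set A) : set A :=
  [set f | exists (N : nat) (a b : 'I_N -> A),
    (forall i, T (b i)) /\ f = \sum_(i < N) a i * b i].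

Section Tropical.
Variable (R : realType) (M : nat).
Local Notation L := (puiseux R).
Local Notation A := {laurent L[M]}.
Implicit Types (f : A) (u v : 'rV[int]_M) (w : 'rV[R]_M).

Definition trop_term f w u : \bar R :=
  (pval (mcoeff u f) + (\sum_i (u 0 i)%:~R * w 0 i)%:E)%E.

Definition trop f w : \bar R :=
  \big[Order.min/+oo%E]_(u <- msupp f) trop_term f w u.

(* The zero polynomial, whose minimum is +oo, defines the whole space. *)
Definition trop_hypersurface f : set 'rV[R]_M :=
  [set w | f = 0 \/ exists u v, [/\ u != v, u \in msupp f, v \in msupp f,
    trop_term f w u = trop f w & trop_term f w v = trop f w]].

Definition leval (x : 'I_M -> L) f : L :=
  \sum_(u <- msupp f) mcoeff u f * \prod_i x i ^ u 0 i.

(* trop (V(I)) is computed from the ideal I, so a subvariety of the torus is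
   given by an ideal; its set of points is the common zero locus. *)
Record torus_variety := TorusVariety { defining_ideal : set A }.

Definition points (X : torus_variety) : set ('I_M -> L) :=
  [set x | (forall i, x i != 0) /\
           forall f, defining_ideal X f -> leval x f = 0].

Definition variety (T : set A) := TorusVariety (ideal_generated T).

Lemma levalw (x : 'I_M -> L) (D : {fset 'rV[int]_M}) f :
  fsubset (msupp f) D ->
  leval x f = \sum_(u <- D) mcoeff u f * \prod_i x i ^ u 0 i.
Proof.
move=> le; apply: big_fset_incl => // u _ /mcoeff_outdom ->.
by rewrite mul0r.
Qed.

Lemma levalD (x : 'I_M -> L) f g : leval x (f + g) = leval x f + leval x g.
Proof.
rewrite (@levalw x _ (f + g) (msuppD_le f g)).
rewrite (@levalw x _ f (fsubsetUl _ (msupp g))).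
rewrite (@levalw x _ g (fsubsetUr (msupp f) _)) -big_split.
by apply: eq_bigr => u _; rewrite mcoeffD mulrDl.
Qed.

Lemma leval0 (x : 'I_M -> L) : leval x 0 = 0.
Proof. by rewrite /leval msupp0 big_seq_fset0. Qed.

Lemma leval_term (x : 'I_M -> L) u (c : L) :
  leval x (lterm u c) = c * \prod_i x i ^ u 0 i.
Proof.
by rewrite (@levalw x _ _ (@msuppU_le _ _ u c)) big_seq_fset1 mcoeffUU.
Qed.

Lemma leval_sum (x : 'I_M -> L) (I : Type) (r : seq I) (F : I -> A) :
  leval x (\sum_(i <- r) F i) = \sum_(i <- r) leval x (F i).
Proof. exact: (big_morph _ (levalD x) (leval0 x)). Qed.

Lemma levalM (x : 'I_M -> L) f g : (forall i, x i != 0) ->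
  leval x (f * g) = leval x f * leval x g.
Proof.
move=> x0; rewrite [f * g]/(lmul f g) /lmul leval_sum {2}/leval mulr_suml.
apply: eq_bigr => u _; rewrite leval_sum {2}/leval mulr_sumr.
apply: eq_bigr => v _; rewrite leval_term mulrACA; congr (_ * _).
by rewrite -big_split; apply: eq_bigr => i _; rewrite mxE expfzDr.
Qed.

Lemma points_variety (T : set A) : points (variety T) =
  [set x | (forall i, x i != 0) /\ forall f, T f -> leval x f = 0].
Proof.
apply/seteqP; split => x [x0 H]; split => // f.
  move=> Tf; apply: H; exists 1%N, (fun=> 1), (fun=> f); split => //.
  by rewrite big_ord1 mul1r.
move=> [N [a [b [Tb ->]]]]; rewrite leval_sum big1 // => i _.
by rewrite levalM // (H _ (Tb i)) mulr0.
Qed.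

Definition trop_variety (X : torus_variety) : set 'rV[R]_M :=
  \bigcap_(f in defining_ideal X) trop_hypersurface f.

Definition tropical_basis (T : set A) (X : torus_variety) :=
  [/\ finite_set T, ideal_generated T = defining_ideal X &
      trop_variety X = \bigcap_(f in T) trop_hypersurface f].

End Tropical.

Section QQSystem.
Variables (R : realType) (q : R[i]) (m n : nat) (d : nat -> R[i]).
Local Notation L := (puiseux R).
Local Notation A := {laurent L[m + n]}.

Definition pconst (a : R[i]) : L := pmonom a 0.
Definition pt : L := pmonom 1 1.

Definition xvar (i : 'I_m) : A := lvar L (lshift n i).
Definition yvar (j : 'I_n) : A := lvar L (rshift m j).

(* The family x_1, ..., x_m, y_1, ..., y_n. *)
Definition join_family (x : 'I_m -> A) (y : 'I_n -> A) (i : 'I_(m + n)) : A :=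
  match fintype.split i with inl j => x j | inr j => y j end.

Definition gQQ (k : nat) : A :=
  let Q := pconst q in
  let D := Q ^+ m - pt * Q ^+ n in
  (Q ^+ m / D) *: esym k (join_family (fun i => Q^-1 *: xvar i) yvar)
  - (pt * Q ^+ n / D) *: esym k (join_family xvar (fun j => Q^-1 *: yvar j))
  - (pconst (d k))%:A.

Definition gQQ_set : set A := gQQ @` [set k | (1 <= k <= m + n)%N].

Definition DefQQ : torus_variety R (m + n) := variety gQQ_set.

End QQSystem.

Arguments gQQ_set {R} q m n d _.

(* Main.v *)
Require Import Defs.
From HB Require Import structures.
From mathcomp Require Import all_boot all_order all_algebra.
From mathcomp Require Import finmap complex.
From mathcomp Require Import all_classical all_reals all_analysis.
From mathcomp Require Import -(notations) monalg.
From mathcomp Require Import -(notations) ssrcomplements mpoly.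
From mathcomp Require Import ring zify.

Set Implicit Arguments.
Unset Strict Implicit.
Unset Printing Implicit Defensive.

Import Order.TTheory GRing.Theory Num.Theory.

Local Open Scope classical_set_scope.
Local Open Scope complex_scope.
Local Open Scope ring_scope.

(** Write M = m + n.  Let O be the ring of Puiseux series of nonnegative
    valuation, with residue map O -> C.  Each g_k is a combination of the
    squarefree monomials of degree k and of a constant; all the coefficients
    lie in O and have nonzero residues, and the residue of g_k is
    e_k(c_1 x_1, ..., c_M x_M) - d_k, where c_i is 1/q on the first m variables
    and 1 on the others ([gQQ_expansion]).

    Upper bound.  As all valuations are 0, membership of w in trop(V(g_k))
    compares 0 with the sums of k coordinates of w.  If w had exactly k > 0
    negative coordinates, their sum would be the unique minimum for g_k; if w
    were nonnegative and nonzero, 0 would be the unique minimum for g_M.  Hence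
    the intersection of the M hypersurfaces is contained in the origin
    ([elementary_trop]).

    Lower bound.  It must be shown that no f in the ideal has a single term of
    least valuation.  Scaling f so that its coefficients are in O and dividing
    by the offending coefficient, the residue of f would be a monomial.  Let x0
    be the point with nonzero coordinates such that the c_i x0_i are the
    opposites of the roots of Lambda; the residues of the g_k vanish at x0, so a
    contradiction follows as soon as the residue of f vanishes at x0.  The
    difficulty is that f is a combination of the g_k with coefficients that may
    have poles, that is, only s f belongs to the ideal of O[x] generated by the
    g_k, for some nonzero s in O: the quotient by this ideal has to be free of
    torsion, up to elements of O with nonzero residue.

    This is where the special shape of the residues is used.  Multiplying
    e(T) = (1 - z_1 T) ... (1 - z_M T) by the generating series of the complete
    symmetric polynomials h in z_i, ..., z_M leaves a polynomial of degree less
    than i.  Comparing coefficients of T^i expresses h_i(z_i, ..., z_M) in the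
    ideal of the elementary symmetric polynomials.  So the ideal of the g_k is
    also generated by polynomials p_i of degree at most i whose residues have
    leading monomial x_i^i ([tsys_lead]).  For an exponent u, written
    u_i = a_i + i b_i with a_i < i, the residue of the product of all the
    x_i^(a_i) p_i^(b_i) has leading monomial u.  In each degree, the matrix of
    these products in the monomial basis therefore has a determinant of nonzero
    residue, so that they form a basis of O[x] up to such determinants
    ([bcomb_inj], [bcomb_onto]).  In that basis the ideal of the p_i is spanned
    by a subset of the basis elements, whence the absence of torsion
    ([triangular_saturation], [deformation_saturation], [lres_eq0]). *)

Local Notation "{ 'mpoly' T [ n ] }" := (mpoly.mpoly n T)
  (at level 0, T, n at level 2, format "{ 'mpoly'  T [ n ] }") : type_scope.
Local Notation "p @_ m" := (mpoly.mcoeff m p)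
  (at level 3, m at level 2, format "p @_ m") : ring_scope.
Local Notation mvar i := (mpolyX _ (mnm1 i)).
Local Notation lcoef := monalg.mcoeff.
Local Notation lsupp := monalg.msupp.

(** * Complete symmetric polynomials against elementary ones *)

Section CompleteSymmetric.
Variable A : comNzRingType.
Implicit Types (z : A) (s t : seq A) (p : {poly A}).

(** The complete symmetric polynomials, by the recursion that says that their
    generating series is multiplied by 1 / (1 - z T) when z is added to the list. *)
Fixpoint hsym s : nat -> A :=
  match s with
  | [::] => fun k => (k == 0)%:R
  | z :: s' => fix hsym_z k := if k is k'.+1 then hsym s' k + z * hsym_z k' else 1
  end.

Arguments hsym : simpl never.

Lemma hsym0 s : hsym s 0 = 1. Proof. by case: s. Qed.

Lemma hsym_nil k : hsym [::] k = (k == 0)%:R. Proof. by []. Qed.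

Lemma hsym_consS z s k : hsym (z :: s) k.+1 = hsym s k.+1 + z * hsym (z :: s) k.
Proof. by []. Qed.

(** The coefficient of T^k in the product of p and of the generating series of
    the complete symmetric polynomials in s. *)
Definition hconv p s k := \sum_(j < k.+1) p`_j * hsym s (k - j).

(** The factor 1 - z T is cancelled by the factor 1 / (1 - z T) that z
    contributes to the generating series. *)
Lemma hconv_cons p z s k : hconv ((1 - z *: 'X) * p) (z :: s) k = hconv p s k.
Proof.
have coefE j : ((1 - z *: 'X) * p)`_j = p`_j - z * (if j is j'.+1 then p`_j' else 0).
  rewrite mulrBl mul1r -scalerAl coefB coefZ coefXM.
  by case: j.
rewrite /hconv; under eq_bigr => j _ do rewrite coefE mulrBl.
rewrite sumrB big_ord_recr /= subnn hsym0 mulr1.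
rewrite [X in _ - X]big_ord_recl /= mulr0 mul0r add0r.
rewrite [RHS]big_ord_recr /= subnn hsym0 mulr1 addrAC -sumrB; congr (_ + _).
apply: eq_bigr => j _; rewrite /bump /= add1n.
have -> : (k - j = (k - j.+1).+1)%N by have := ltn_ord j; lia.
by rewrite [hsym (_ :: _) _.+1]hsym_consS; ring.
Qed.

Lemma hconv_prod s t k :
  hconv (\prod_(z <- t ++ s) (1 - z *: 'X)) s k = (\prod_(z <- t) (1 - z *: 'X))`_k.
Proof.
elim: s t => [|z s IH] t.
  rewrite cats0 /hconv big_ord_recr /= subnn hsym0 mulr1 big1 ?add0r // => j _.
  by rewrite hsym_nil subn_eq0 leqNgt ltn_ord mulr0.
rewrite big_cat big_cons /= mulrCA hconv_cons -IH.
by rewrite big_cat.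
Qed.

Lemma coef_prod_1subZX M (z : 'I_M -> A) k :
  (\prod_i (1 - z i *: 'X))`_k = (-1) ^+ k * Defs.esym k z.
Proof.
under eq_bigr do rewrite addrC.
rewrite bigA_distr coef_sum /Defs.esym mulr_sumr [RHS]big_mkcond; apply: eq_bigr => S _.
rewrite -big_mkcond /=.
have -> : \prod_(i in S) - (z i *: 'X) =
    ((-1) ^+ #|S| * \prod_(i in S) z i) *: 'X^#|S| :> {poly A}.
  by under eq_bigr do rewrite -scaleNr; rewrite scaler_prod prodrN prodr_const.
rewrite coefZ coefXn eq_sym; case: eqP => [->|_]; first by rewrite mulr1.
by rewrite mulr0.
Qed.

Lemma size_prod_1subZX s : (size (\prod_(z <- s) (1 - z *: 'X))%R <= (size s).+1)%N.
Proof.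
elim: s => [|z s IH]; first by rewrite big_nil size_poly1.
rewrite big_cons; apply: leq_trans (size_polyMleq _ _) _.
have : (size (1 - z *: 'X : {poly A})%R <= 2)%N.
  apply: leq_trans (size_polyD _ _) _; rewrite geq_max size_poly1 size_polyN /=.
  by apply: leq_trans (size_scale_leq _ _) _; rewrite size_polyX.
by move=> h; rewrite -subn1 leq_subLR (leq_trans (leq_add h IH)).
Qed.

(** After cancellation of the factors of the z_j with i <= j, only a polynomial in
    T of degree i is left, and its coefficient of T^(i+1) vanishes. *)
Lemma esym_hsym M (z : 'I_M -> A) (i : 'I_M) :
  \sum_(k < i.+2) (-1) ^+ k * Defs.esym k z
    * hsym [seq z j | j <- drop i (enum 'I_M)] (i.+1 - k) = 0.
Proof.
set s := map _ _; pose t := [seq z j | j <- take i (enum 'I_M)].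
have tsE : t ++ s = map z (enum 'I_M) by rewrite -map_cat cat_take_drop.
have prodE : \prod_(y <- t ++ s) (1 - y *: 'X) = \prod_i (1 - z i *: 'X).
  by rewrite tsE big_map big_enum.
transitivity (hconv (\prod_(y <- t ++ s) (1 - y *: 'X)) s i.+1).
  by rewrite prodE; apply: eq_bigr => k _; rewrite coef_prod_1subZX.
rewrite hconv_prod nth_default //.
apply: leq_trans (size_prod_1subZX _) _.
by rewrite size_map size_take size_enum_ord ltn_ord.
Qed.

End CompleteSymmetric.
Arguments hsym {A} s : simpl never.

Lemma rmorph_hsym (A B : comNzRingType) (f : {rmorphism A -> B}) s k :
  f (hsym s k) = hsym [seq f z | z <- s] k.
Proof.
elim: s k => [|z s IH] k; first by rewrite !hsym_nil rmorph_nat.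
elim: k => [|k IHk]; first by rewrite !hsym0 rmorph1.
by rewrite map_cons !hsym_consS rmorphD rmorphM IH -IHk.
Qed.

(** * Degrees and leading monomials *)

Section Degree.
Variables (A : comNzRingType) (M : nat).
Implicit Types (p r : {mpoly A[M]}).

Definition deg_le k p := (msize p <= k.+1)%N.

Lemma deg_leP k p : reflect (forall m, (k < mdeg m)%N -> p@_m = 0) (deg_le k p).
Proof.
apply: (iffP idP) => [h m km|h].
  by apply: memN_msupp_eq0; apply: msize_mdeg_ge; apply: leq_trans km.
rewrite /deg_le msizeE; apply/bigmax_leqP_seq => m; rewrite ltnS leqNgt mcoeff_msupp => pm _.
by apply: contra pm => /h ->.
Qed.

Lemma deg_leW k l p : (k <= l)%N -> deg_le k p -> deg_le l p.
Proof. by move=> kl h; apply: leq_trans h _. Qed.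

Lemma deg_leD k p r : deg_le k p -> deg_le k r -> deg_le k (p + r).
Proof. by move=> hp hr; apply: leq_trans (msizeD_le _ _) _; rewrite geq_max; apply/andP. Qed.

Lemma deg_le_sum k (I : Type) (s : seq I) (P : pred I) (F : I -> {mpoly A[M]}) :
  (forall i, P i -> deg_le k (F i)) -> deg_le k (\sum_(i <- s | P i) F i).
Proof.
move=> h; elim/big_ind: _ => //; last by move=> p r; exact: deg_leD.
by rewrite /deg_le msize0.
Qed.

Lemma deg_leZ k a p : deg_le k p -> deg_le k (a *: p).
Proof. by move=> h; apply: leq_trans (msizeZ_le _ _) _. Qed.

Lemma deg_leM k l p r : deg_le k p -> deg_le l r -> deg_le (k + l) (p * r).
Proof.
move=> hp hr; apply/deg_leP => m hm; apply/eqP; rewrite mcoeff_eq0.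
apply/negP => /msuppM_le /allpairsP[[m1 m2] /= [m1p m2r mE]].
have := msize_mdeg_lt m1p; have := msize_mdeg_lt m2r.
move: hm hp hr; rewrite /deg_le mE mdegD; lia.
Qed.

Lemma deg_le1 : deg_le 0 (1 : {mpoly A[M]}).
Proof. by rewrite /deg_le msize1. Qed.

Lemma deg_leX k p j : deg_le k p -> deg_le (k * j) (p ^+ j).
Proof.
move=> hp; elim: j => [|j IH]; first by rewrite muln0; exact: deg_le1.
by rewrite exprS mulnS; apply: deg_leM.
Qed.

Lemma deg_le_prod (I : Type) (s : seq I) (k : I -> nat) (F : I -> {mpoly A[M]}) :
  (forall i, deg_le (k i) (F i)) -> deg_le (\sum_(i <- s) k i) (\prod_(i <- s) F i).
Proof.
move=> h; elim: s => [|i s IH]; first by rewrite !big_nil; exact: deg_le1.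
by rewrite !big_cons; apply: deg_leM.
Qed.

Lemma deg_le_mvar (i : 'I_M) : deg_le 1 (mvar i : {mpoly A[M]}).
Proof. by rewrite /deg_le msizeX mdeg1. Qed.

Lemma deg_le_hsym (s : seq {mpoly A[M]}) k :
  all (deg_le 1) s -> deg_le k (hsym s k).
Proof.
elim: s k => [|z s IH] k /=.
  by move=> _; rewrite hsym_nil; case: eqP => _; rewrite /deg_le ?msize1 ?msize0.
case/andP=> hz hs; elim: k => [|k IHk]; first by rewrite hsym0; exact: deg_le1.
rewrite hsym_consS; apply: deg_leD; first exact: IH.
by rewrite -add1n; apply: deg_leM.
Qed.

End Degree.

Section Leading.
Variables (K : fieldType) (M : nat) (c : 'I_M -> K).
Hypothesis c0 : forall i, c i != 0.

Lemma mnm1_mul_lt (i j : 'I_M) k : (i < j)%N ->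
  (mnm_muln (mnm1 j) k.+1 < mnm_muln (mnm1 i) k.+1)%O.
Proof.
move=> ij; apply/ltmcP; first by rewrite !mdegMn !mdeg1.
have mE (a b : 'I_M) : mnm_muln (mnm1 a) k.+1 b = ((a == b) * k.+1)%N.
  by rewrite mulmnE mnm1E.
exists i => [l li|]; rewrite !mE.
  by rewrite -!(inj_eq val_inj) /= !gtn_eqF // (ltn_trans li).
by rewrite eqxx -(inj_eq val_inj) /= (gtn_eqF ij).
Qed.

(** Monomials are compared by degree first, then lexicographically with the
    variables of small index dominating; so in the recursion for the complete
    symmetric polynomial of degree k in c_i x_i and later variables it is the term
    containing x_i that leads. *)
Lemma mlead_hsym (i : 'I_M) (js : seq 'I_M) k :
  path (fun a b : 'I_M => a < b)%N i js ->
  let h := hsym [seq c j *: mvar j | j <- i :: js] k in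
  mlead h = mnm_muln (mnm1 i) k /\ h != 0.
Proof.
elim: js i k => [|j js IH] i k /= pth; elim: k => [|k [IHl IH0]].
- by rewrite hsym0 mlead1 mulm0n oner_neq0.
- have x0 : c i *: mvar i != 0 :> {mpoly K[M]}.
    by rewrite mscalerI negb_or c0 -mleadc_eq0 mleadXm mcoeffX eqxx oner_neq0.
  rewrite hsym_consS hsym_nil add0r mleadM // IHl mleadZ // mleadXm mulmS.
  by rewrite mulf_neq0.
- by rewrite hsym0 mlead1 mulm0n oner_neq0.
- have x0 : c i *: mvar i != 0 :> {mpoly K[M]}.
    by rewrite mscalerI negb_or c0 -mleadc_eq0 mleadXm mcoeffX eqxx oner_neq0.
  case/andP: pth => ij pth; have [hl _] := IH j k.+1 pth.
  rewrite hsym_consS; set h := hsym _ k.+1; set h' := hsym _ k.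
  have hl' : mlead (c i *: mvar i * h') = mnm_muln (mnm1 i) k.+1.
    by rewrite mleadM // IHl mleadZ // mleadXm mulmS.
  have lt : (mlead h < mlead (c i *: mvar i * h'))%O.
    by rewrite hl' hl; exact: mnm1_mul_lt.
  split; first by rewrite mleadDr // hl'.
  apply/eqP => h0; have := mleadDr lt; rewrite h0 mlead0 hl' => /(congr1 mdeg).
  by rewrite mdeg0 mdegMn mdeg1 mul1n.
Qed.

Lemma sorted_drop_enum (i : 'I_M) : exists2 js,
  drop i (enum 'I_M) = i :: js & path (fun a b : 'I_M => a < b)%N i js.
Proof.
exists (drop i.+1 (enum 'I_M)).
  rewrite (drop_nth i) ?size_enum_ord // nth_ord_enum //.
have : sorted (fun a b : 'I_M => a < b)%N (enum 'I_M).
  by have := iota_ltn_sorted 0 M; rewrite -val_enum_ord sorted_map.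
rewrite -{1}(cat_take_drop i (enum 'I_M)) (drop_nth i) ?size_enum_ord //.
by rewrite nth_ord_enum => /cat_sorted2 [].
Qed.
End Leading.

(** * Bases of O[x] lifted from residues *)

Section PerturbedBasis.
Variables (A : comNzRingType) (K : fieldType) (res : {rmorphism A -> K}) (M : nat).
Variable b : multinom M -> {mpoly A[M]}.
Hypothesis domA : forall x y : A, x * y = 0 -> x = 0 \/ y = 0.
Hypothesis b_deg : forall u, deg_le (mdeg u) (b u).
Hypothesis b_lead : forall u, mlead (map_mpoly res (b u)) = u.
Hypothesis b_neq0 : forall u, map_mpoly res (b u) != 0.
Implicit Types (C F : {mpoly A[M]}).

Definition bcomb C := \sum_(u <- mpoly.msupp C) C@_u *: b u.

Lemma bcombwE C k : (msize C <= k)%N ->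
  bcomb C = \sum_(u : bmultinom M k) C@_u *: b u.
Proof.
move=> le_Ck; pose I : subFinType _ := bmultinom M k.
rewrite /bcomb (big_mksub I) //=; first last.
  by move=> x /msize_mdeg_lt /leq_trans; apply.
  by rewrite msupp_uniq.
by rewrite big_rmcond //= => i; move/memN_msupp_eq0 ->; rewrite scale0r.
Qed.

Lemma bcombD C C' : bcomb (C + C') = bcomb C + bcomb C'.
Proof.
pose k := maxn (msize C) (msize C').
rewrite (@bcombwE _ k) ?msizeD_le // (@bcombwE C k) ?leq_maxl //.
rewrite (@bcombwE C' k) ?leq_maxr // -big_split; apply: eq_bigr => u _.
by rewrite mcoeffD scalerDl.
Qed.

Lemma bcombZ a C : bcomb (a *: C) = a *: bcomb C.
Proof.
rewrite (@bcombwE _ (msize C)) ?msizeZ_le // (@bcombwE C (msize C)) //.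
by rewrite scaler_sumr; apply: eq_bigr => u _; rewrite mcoeffZ scalerA.
Qed.

Lemma bcomb0 : bcomb 0 = 0.
Proof. by rewrite -[X in bcomb X](scale0r 0) bcombZ scale0r. Qed.

Lemma bcomb_sum (I : Type) (s : seq I) (P : pred I) (F : I -> {mpoly A[M]}) :
  bcomb (\sum_(i <- s | P i) F i) = \sum_(i <- s | P i) bcomb (F i).
Proof. exact: (big_morph _ bcombD bcomb0). Qed.

Lemma bcombX u : bcomb (mpolyX A u) = b u.
Proof. by rewrite /bcomb msuppX big_seq1 mcoeffX eqxx scale1r. Qed.

(** Only the exponents of degree less than k are involved: as the degree of [b u]
    is at most that of u, truncation gives square matrices. *)
Definition bmat k : 'M[A]_#|{: bmultinom M k}| :=
  \matrix_(i, j) (b (bmnm (enum_val i)))@_(bmnm (enum_val j)).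

Definition brow k C : 'rV[A]_#|{: bmultinom M k}| :=
  \row_i C@_(bmnm (enum_val i)).

(** In degree less than k, [bcomb] is the linear map of matrix [bmat k]. *)
Lemma brow_bcomb k C : (msize C <= k)%N -> brow k (bcomb C) = brow k C *m bmat k.
Proof.
move=> Ck; apply/rowP => j; rewrite !mxE (bcombwE Ck) raddf_sum /=.
rewrite (reindex _ (onW_bij _ (@enum_val_bij _))) /=; apply: eq_bigr => i _.
by rewrite !mxE mcoeffZ.
Qed.

Lemma brow_inj k C C' : (msize C <= k)%N -> (msize C' <= k)%N ->
  brow k C = brow k C' -> C = C'.
Proof.
move=> Ck Ck' /rowP eqr; apply/mpolyP => m.
case: (ltnP (mdeg m) k) => mk.
  by have := eqr (enum_rank (BMultinom mk)); rewrite !mxE enum_rankK.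
by rewrite !memN_msupp_eq0 // msize_mdeg_ge // (leq_trans _ mk).
Qed.

(** A nonzero vector in the left kernel of the residue matrix would give a relation
    between the residues of the b u; but the largest u that occurs in it is the
    leading monomial of exactly one of them. *)
Lemma res_det_bmat k : res (\det (bmat k)) != 0.
Proof.
rewrite -det_map_mx; apply/negP => /det0P[v v0 vB].
pose c (u : bmultinom M k) := v 0 (enum_rank u).
have [u0 cu0] : exists u, c u != 0.
  case/rV0Pn: v0 => i vi; exists (enum_val i).
  by rewrite /c enum_valK.
case: (@Order.TotalTheory.arg_maxP _ _ _ u0 (fun u => c u != 0) (fun u => bmnm u) cu0).
move=> u cu umax; case/eqP: cu.
have := congr1 (fun w : 'rV_ _ => w 0 (enum_rank u)) vB; rewrite !mxE.
rewrite (reindex _ (onW_bij _ (@enum_rank_bij _))) /= (bigD1 u) //=.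
rewrite big1 ?addr0 => [|w wu].
  rewrite !mxE !enum_rankK -mcoeff_map_mpoly => /eqP.
  rewrite mulf_eq0 -{1}(b_lead (bmnm u)) mleadc_eq0 (negbTE (b_neq0 _)) orbF.
  by move/eqP.
rewrite !mxE !enum_rankK -mcoeff_map_mpoly; case: (eqVneq (c w) 0) => cw.
  by rewrite -/(c w) cw mul0r.
have wle : (bmnm w <= bmnm u)%O by exact: umax.
rewrite mcoeff_gt_mlead ?mulr0 // b_lead lt_neqAle wle andbT.
by apply: contra wu => /eqP wu; apply/eqP/val_inj.
Qed.

Lemma det_bmat_neq0 k : \det (bmat k) != 0.
Proof. by apply: contraNneq (res_det_bmat k) => ->; rewrite rmorph0. Qed.

Lemma bcomb_inj C : bcomb C = 0 -> C = 0.
Proof.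
move=> C0; pose k := msize C.
apply: (@brow_inj k); rewrite ?msize0 //.
have : \det (bmat k) *: brow k C = 0.
  rewrite -mul_mx_scalar -mul_mx_adj mulmxA -brow_bcomb // C0.
  by rewrite [brow k 0](_ : _ = 0) ?mul0mx //; apply/rowP => i; rewrite !mxE mcoeff0.
move/rowP => h; apply/rowP => i; have := h i; rewrite !mxE mcoeff0 => /domA[] //.
by move/eqP; rewrite (negbTE (det_bmat_neq0 k)).
Qed.

Lemma msize_bcomb k C : (msize C <= k)%N -> (msize (bcomb C) <= k)%N.
Proof.
case: k => [|k] Ck.
  have /eqP -> : C == 0 by rewrite -msize_poly_eq0 -leqn0.
  by rewrite bcomb0 msize0.
rewrite (bcombwE Ck); apply: deg_le_sum => u _; apply: deg_leZ.
by apply: deg_leW (b_deg _); rewrite -ltnS bmdeg.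
Qed.

(** Cramer's rule; the determinant has nonzero residue but need not be
    invertible, since A is not assumed to be local. *)
Lemma bcomb_onto k F : (msize F <= k)%N -> exists C,
  \det (bmat k) *: F = bcomb C.
Proof.
move=> Fk; pose v := brow k F *m \adj (bmat k).
pose C := \sum_(u : bmultinom M k) v 0 (enum_rank u) *: mpolyX A u.
have Ck : (msize C <= k)%N.
  apply: leq_trans (msize_sum _ _ _) _; apply/bigmax_leqP => u _.
  by apply: leq_trans (msizeZ_le _ _) _; rewrite msizeX bmdeg.
have CE : brow k C = v.
  apply/rowP => i; rewrite mxE raddf_sum /= (bigD1 (enum_val i)) //= big1 ?addr0.
    by rewrite mcoeffZ mcoeffX eqxx mulr1 enum_valK.
  move=> u ui; rewrite mcoeffZ mcoeffX; case: eqP => [/val_inj uE|_]; last by rewrite mulr0.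
  by rewrite uE eqxx in ui.
exists C; apply: (@brow_inj k); first by apply: leq_trans (msizeZ_le _ _) _.
  exact: msize_bcomb.
rewrite brow_bcomb // CE -mulmxA mul_adj_mx mul_mx_scalar.
by apply/rowP => i; rewrite !mxE mcoeffZ.
Qed.

End PerturbedBasis.

(** * Triangular systems *)

Section TriangularSystem.
Variables (A : comNzRingType) (K : fieldType) (res : {rmorphism A -> K}) (M : nat).
Hypothesis domA : forall x y : A, x * y = 0 -> x = 0 \/ y = 0.
Variables (p : 'I_M -> {mpoly A[M]}) (D : 'I_M -> nat).
Hypothesis D_gt0 : forall i, (0 < D i)%N.
Hypothesis p_deg : forall i, deg_le (D i) (p i).
Hypothesis p_lead : forall i, mlead (map_mpoly res (p i)) = mnm_muln (mnm1 i) (D i).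
Hypothesis p_neq0 : forall i, map_mpoly res (p i) != 0.

(** For D i = i + 1 and p the system of residues, the exponents u with all
    u i < D i index a basis of the coinvariant algebra. *)
Definition pbasis (u : multinom M) : {mpoly A[M]} :=
  \prod_i (mvar i ^+ (u i %% D i) * p i ^+ (u i %/ D i)).

Lemma pbasis_deg u : deg_le (mdeg u) (pbasis u).
Proof.
have -> : mdeg u = (\sum_i (1 * (u i %% D i) + D i * (u i %/ D i)))%N.
  rewrite mdegE; apply: eq_bigr => i _.
  by rewrite mul1n mulnC addnC -divn_eq.
apply: deg_le_prod => i; apply: deg_leM; apply: deg_leX; last exact: p_deg.
exact: deg_le_mvar.
Qed.

Let factor_neq0 (u : multinom M) i :
  (mvar i ^+ (u i %% D i) * map_mpoly res (p i) ^+ (u i %/ D i) : {mpoly K[M]}) != 0.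
Proof.
by rewrite mulf_neq0 ?expf_neq0 ?p_neq0 // -mleadc_eq0 mleadXm mcoeffX eqxx oner_neq0.
Qed.

Lemma res_pbasis u : map_mpoly res (pbasis u) =
  \prod_i (mvar i ^+ (u i %% D i) * map_mpoly res (p i) ^+ (u i %/ D i)).
Proof.
rewrite rmorph_prod; apply: eq_bigr => i _.
by rewrite rmorphM !rmorphXn /= map_mpolyX.
Qed.

Lemma pbasis_neq0 u : map_mpoly res (pbasis u) != 0.
Proof. by rewrite res_pbasis; apply/prodf_neq0 => i _. Qed.

Lemma pbasis_lead u : mlead (map_mpoly res (pbasis u)) = u.
Proof.
rewrite res_pbasis mlead_prod => [|i _ _ //].
rewrite [RHS]multinomUE_id; apply: eq_bigr => i _.
have := factor_neq0 u i; rewrite mulf_eq0 negb_or => /andP[h1 h2].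
have x0 : mvar i != 0 :> {mpoly K[M]}.
  by rewrite -mleadc_eq0 mleadXm mcoeffX eqxx oner_neq0.
rewrite mleadM // !mleadX ?p_neq0 // mleadXm p_lead; apply/mnmP => j.
rewrite mnmDE !mulmnE mnm1E; case: eqP => [_|_]; last by rewrite !mul0n.
by rewrite !mul1n mulnC addnC -divn_eq.
Qed.

Lemma pbasis_mul u i : pbasis u * p i = pbasis (mnm_add u (mnm_muln (mnm1 i) (D i))).
Proof.
rewrite /pbasis (bigD1 i) //= [RHS](bigD1 i) //= mulrAC; congr (_ * _).
  rewrite mnmDE mulmnE mnm1E eqxx mul1n modnDr divnDr // divnn D_gt0 addn1 exprSr.
  by rewrite mulrA.
apply: eq_bigr => j ji; rewrite mnmDE mulmnE mnm1E eq_sym (negbTE ji) mul0n.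
by rewrite addn0.
Qed.

Local Notation pcomb := (bcomb pbasis).

(** Multiplication by p i shifts the basis, as [pbasis_mul] says: the module over
    the polynomials in the p i is free. *)
Lemma pcomb_mul (C : {mpoly A[M]}) i :
  pcomb C * p i = pcomb (C * mpolyX A (mnm_muln (mnm1 i) (D i))).
Proof.
set m := mnm_muln _ _.
have -> : C * mpolyX A m = \sum_(u <- mpoly.msupp C) C@_u *: mpolyX A (mnm_add u m).
  rewrite [X in X * _ = _](mpolyE C) mulr_suml; apply: eq_bigr => u _.
  by rewrite -scalerAl -mpolyXD.
rewrite bcomb_sum mulr_suml; apply: eq_bigr => u _.
by rewrite -scalerAl bcombZ bcombX pbasis_mul.
Qed.

Lemma mcoeff_mulX_eq0 (C : {mpoly A[M]}) i (u : multinom M) : (u i < D i)%N ->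
  (C * mpolyX A (mnm_muln (mnm1 i) (D i)))@_u = 0.
Proof.
move=> ui; apply/eqP; rewrite mcoeff_eq0; apply/negP => /msuppM_le.
case/allpairsP => -[m1 m2] /= [_]; rewrite msuppX inE => /eqP -> uE.
by move: ui; rewrite uE mnmDE mulmnE mnm1E eqxx mul1n ltnNge leq_addl.
Qed.

(** Up to residually nonzero factors, F and the a i are combinations of the basis
    elements.  As multiplication by p i shifts the basis, those occurring in s F
    all contain some p i; since s is not a zero divisor the same holds for F, which
    therefore vanishes at every residual zero of the p i. *)
Lemma triangular_saturation (x0 : 'I_M -> K) (s : A) (F : {mpoly A[M]}) a :
  (forall i, mmap res x0 (p i) = 0) -> s != 0 ->
  s *: F = \sum_i a i * p i -> mmap res x0 F = 0.
Proof.
move=> px0 s0 sF; pose k := maxn (msize F) (\max_i msize (a i)).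
pose delta := \det (bmat pbasis k).
have onto := bcomb_onto pbasis_deg.
have [C CE] : exists C, delta *: F = pcomb C by apply: onto; exact: leq_maxl.
have [B BE] : exists B : 'I_M -> _, forall i, delta *: a i = pcomb (B i).
  apply: (@fin_all_exists _ (fun=> {mpoly A[M]}) (fun i B => delta *: a i = pcomb B)) => i.
  apply: onto.
  by apply: leq_trans (leq_maxr _ _); exact: (leq_bigmax i).
have sC : s *: C = \sum_i B i * mpolyX A (mnm_muln (mnm1 i) (D i)).
  apply/eqP; rewrite -subr_eq0; apply/eqP.
  apply: (bcomb_inj domA pbasis_lead pbasis_neq0).
  rewrite bcombD -scaleN1r !bcombZ -CE bcomb_sum scalerA mulrC -scalerA sF.
  rewrite scaler_sumr scaleN1r; apply/eqP; rewrite subr_eq0; apply/eqP.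
  by apply: eq_bigr => i _; rewrite scalerAl BE pcomb_mul.
have C0 (u : multinom M) : (forall i, (u i < D i)%N) -> C@_u = 0.
  move=> ulow; have : s * C@_u = 0.
    rewrite -mcoeffZ sC raddf_sum big1 // => i _ /=; exact: mcoeff_mulX_eq0.
  by move/domA => [] // /eqP; rewrite (negbTE s0).
have : res delta * mmap res x0 F = 0.
  rewrite -mmapZ CE /bcomb raddf_sum big1 // => u _ /=; rewrite mmapZ.
  case: (boolP [forall i, (u i < D i)%N]) => [/forallP /C0 ->|].
    by rewrite rmorph0 mul0r.
  case/forallPn => i; rewrite -leqNgt => ui.
  rewrite /pbasis (bigD1 i) //= !rmorphM /= !rmorphXn /= px0 expr0n.
  by rewrite eqn0Ngt divn_gt0 // ui /= !(mulr0, mul0r).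
move/eqP; rewrite mulf_eq0.
by rewrite (negbTE (res_det_bmat pbasis_lead pbasis_neq0 k)) => /eqP.
Qed.

End TriangularSystem.

(** * Deformations of the elementary symmetric system *)

Lemma esym0 (A : comNzRingType) M (z : 'I_M -> A) : Defs.esym 0 z = 1.
Proof.
rewrite /Defs.esym (big_pred1 finset.set0) ?big_set0 // => S.
by rewrite cards_eq0.
Qed.

(** The g k are polynomials over A whose residues are the equations
    e_k(c_1 x_1, ..., c_M x_M) = d_k.  [tsys] gives triangular generators of the
    same ideal. *)
Section Deformation.
Variables (A : comNzRingType) (K : fieldType) (res : {rmorphism A -> K}) (M : nat).
Hypothesis domA : forall x y : A, x * y = 0 -> x = 0 \/ y = 0.
Variables (c : 'I_M -> A) (d : nat -> K) (g : nat -> {mpoly A[M]}).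
Hypothesis c_neq0 : forall i, res (c i) != 0.
Hypothesis g_deg : forall k, (k < M)%N -> deg_le k.+1 (g k.+1).
Hypothesis res_g : forall k, (k < M)%N -> map_mpoly res (g k.+1) =
  Defs.esym k.+1 (fun i => res (c i) *: mvar i) - mpolyC M (d k.+1).

Definition hsys (i : 'I_M) (k : nat) : {mpoly A[M]} :=
  hsym [seq c j *: mvar j | j <- drop i (enum 'I_M)] k.

Definition tsys (i : 'I_M) : {mpoly A[M]} :=
  \sum_(k < i.+1) (-1) ^+ k.+1 *: (hsys i (i - k) * g k.+1).

Let ltM (i : 'I_M) (k : 'I_i.+1) : (k < M)%N.
Proof. by apply: leq_ltn_trans (ltn_ord i); rewrite -ltnS. Qed.

Lemma hsys_deg i k : deg_le k (hsys i k).
Proof.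
apply: deg_le_hsym; apply/allP => _ /mapP[j _ ->].
by apply: deg_leZ; exact: deg_le_mvar.
Qed.

Lemma tsys_deg (i : 'I_M) : deg_le i.+1 (tsys i).
Proof.
apply: deg_le_sum => k _; apply: deg_leZ.
have ik : (i - k + k.+1 <= i.+1)%N by have := ltn_ord k; lia.
by apply: deg_leW ik _; apply: deg_leM; [exact: hsys_deg | exact/g_deg/ltM].
Qed.

Lemma res_hsys i k : map_mpoly res (hsys i k) =
  hsym [seq res (c j) *: mvar j | j <- drop i (enum 'I_M)] k.
Proof.
rewrite /hsys rmorph_hsym -map_comp; congr (hsym _ _).
by apply: eq_map => j; rewrite /= map_mpolyZ map_mpolyX.
Qed.

(** By [esym_hsym] the combination that defines [tsys] would be zero if its term
    with k = 0, where e_0 = 1, were included and all d_k were 0. *)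
Lemma res_tsys i : map_mpoly res (tsys i) =
  - map_mpoly res (hsys i i.+1) -
  \sum_(k < i.+1) ((-1) ^+ k.+1 * d k.+1) *: map_mpoly res (hsys i (i - k)).
Proof.
have := esym_hsym (fun j => res (c j) *: mvar j : {mpoly K[M]}) i.
rewrite big_ord_recl /= expr0 esym0 !mul1r subn0 -res_hsys => /eqP.
rewrite addr_eq0 => /eqP ->; rewrite opprK -sumrB rmorph_sum.
apply: eq_bigr => k _; rewrite /bump /= add1n subSS -res_hsys.
rewrite map_mpolyZ rmorphM /= res_g ?ltM // rmorphXn rmorphN1.
rewrite mulrBr scalerBr; congr (_ - _).
  by rewrite -mul_mpolyC rmorphXn rmorphN1 -mulrA [RHS]mulrA [X in _ = X]mulrC mulrCA mulrC.
by rewrite [X in _ *: X]mulrC mul_mpolyC scalerA.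
Qed.

Lemma tsys_lead i : mlead (map_mpoly res (tsys i)) = mnm_muln (mnm1 i) i.+1 /\
  map_mpoly res (tsys i) != 0.
Proof.
have [js jsE js_path] := sorted_drop_enum i.
have [hl h0] := mlead_hsym c_neq0 i.+1 js_path.
rewrite res_tsys !res_hsys jsE; set h := hsym _ i.+1 in hl h0 *.
set r := \sum_(k < _) _.
have r_deg : deg_le i r.
  apply: deg_le_sum => k _; apply: deg_leZ; rewrite res_hsys.
  apply: deg_leW (leq_subr k i) _; apply: deg_le_hsym; apply/allP => _ /mapP[j _ ->].
  by apply: deg_leZ; exact: deg_le_mvar.
have lt : (mlead (- r) < mlead (- h))%O.
  rewrite !mleadN hl; apply: lt_mdeg_ltmc; rewrite mdegMn mdeg1 mul1n ltnS.
  case: (eqVneq r 0) => [->|r0]; first by rewrite mlead0 mdeg0.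
  by rewrite -ltnS mlead_deg.
have lE := mleadDl lt; split; first by rewrite lE mleadN.
apply/eqP => e0; move: lE; rewrite e0 mlead0 mleadN hl => /(congr1 mdeg).
by rewrite mdeg0 mdegMn mdeg1 mul1n.
Qed.

Definition tspan (F : {mpoly A[M]}) := exists a, F = \sum_i a i * tsys i.

Lemma tspanD F G : tspan F -> tspan G -> tspan (F + G).
Proof.
move=> [a ->] [a' ->]; exists (fun i => a i + a' i).
by rewrite -big_split; apply: eq_bigr => i _; rewrite mulrDl.
Qed.

Lemma tspanM G F : tspan F -> tspan (G * F).
Proof.
move=> [a ->]; exists (fun i => G * a i); rewrite mulr_sumr.
by apply: eq_bigr => i _; rewrite mulrA.
Qed.

Lemma tspan_sum (I : Type) (s : seq I) (F : I -> {mpoly A[M]}) :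
  (forall i, tspan (F i)) -> tspan (\sum_(i <- s) F i).
Proof.
move=> h; elim/big_ind: _ => //; last exact: tspanD.
by exists (fun=> 0); rewrite big1 // => i _; rewrite mul0r.
Qed.

Lemma tspan_tsys i : tspan (tsys i).
Proof.
exists (fun j => (j == i)%:R); rewrite (bigD1 i) //= eqxx mul1r big1 ?addr0 //.
by move=> j /negbTE ->; rewrite mul0r.
Qed.

(** In the definition of [tsys] the last coefficient is h_0 = 1, up to sign, so
    that it can be solved for the g k one after the other. *)
Lemma tspan_g k : (k < M)%N -> tspan (g k.+1).
Proof.
elim/ltn_ind: k => k IH kM; pose i := Ordinal kM.
have gE : g k.+1 = (-1) ^+ k.+1 * (tsys i -
    \sum_(l < k) (-1) ^+ l.+1 *: (hsys i (k - l) * g l.+1)).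
  rewrite /tsys big_ord_recr /= addrAC subrr add0r subnn /hsys hsym0 mul1r.
  by rewrite -mul_mpolyC rmorphXn rmorphN1 mulrA -expr2 sqrr_sign mul1r.
rewrite gE; apply: tspanM; apply: tspanD; first exact: tspan_tsys.
rewrite -[X in tspan X]mulN1r; apply: tspanM; apply: tspan_sum => l.
rewrite -mul_mpolyC; apply: tspanM; apply: tspanM.
by apply: IH => //; exact: ltn_trans (ltn_ord l) kM.
Qed.

(** As the g k and the [tsys i] generate the same ideal, what holds for triangular
    systems carries over to the g k. *)
Theorem deformation_saturation (x0 : 'I_M -> K) (s : A) (F : {mpoly A[M]})
    N (a : 'I_N -> {mpoly A[M]}) (k : 'I_N -> 'I_M) :
  (forall j, (j < M)%N -> mmap res x0 (g j.+1) = 0) -> s != 0 ->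
  s *: F = \sum_i a i * g (k i).+1 -> mmap res x0 F = 0.
Proof.
move=> gx0 s0 sF.
have [b sFb] : tspan (s *: F).
  by rewrite sF; apply: tspan_sum => i; apply: tspanM; exact: tspan_g.
have lead i := (tsys_lead i).1; have neq0 i := (tsys_lead i).2.
apply: (triangular_saturation domA _ tsys_deg lead neq0 _ s0 sFb) => // i.
rewrite raddf_sum big1 // => j _ /=.
by rewrite mmapZ rmorphM /= gx0 ?ltM // !mulr0.
Qed.

End Deformation.

(** * The valuation ring of the Puiseux field *)

Section ValuationRing.
Variable R : realType.
Local Notation C := (R[i]).
Local Notation L := (puiseux R).
Implicit Types (f g : L).

Lemma pcoefD f g r : pcoef (f + g) r = pcoef f r + pcoef g r. Proof. by []. Qed.
Lemma pcoefN f r : pcoef (- f) r = - pcoef f r. Proof. by []. Qed.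
Lemma pcoef_one r : pcoef (1 : L) r = (r == 0)%:R.
Proof. by change ((if r == 0 then 1 else 0) = (r == 0)%:R :> C); case: eqP. Qed.
Lemma pcoef_monom a s r : pcoef (pmonom a s : L) r = if r == s then a else 0.
Proof. by []. Qed.

(** For a monomial, or at the least possible exponent of a product, a single term
    of the convolution survives. *)
Lemma pcoefM_single f g (r a0 : rat) :
  (forall a, a != a0 -> pcoef f a * pcoef g (r - a) = 0) ->
  pcoef (f * g) r = pcoef f a0 * pcoef g (r - a0).
Proof.
move=> h; change (pconv (pcoef f) (pcoef g) r = pcoef f a0 * pcoef g (r - a0)).
rewrite /pconv (fsbigE [:: a0]) //; first by rewrite big_mkcond big_seq1 in_setT.
by move=> a _; rewrite inE => /h.
Qed.

Lemma pcoef_monomM a s f r : pcoef (pmonom a s * f) r = a * pcoef f (r - s).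
Proof.
rewrite (@pcoefM_single _ _ _ s) => [|b bs]; first by rewrite pcoef_monom eqxx.
by rewrite pcoef_monom (negbTE bs) mul0r.
Qed.

Definition integral_series : {pred L} :=
  fun f => `[< forall r, r < 0 -> pcoef f r = 0 >].

Lemma integral_seriesP f : reflect (forall r, r < 0 -> pcoef f r = 0) (f \in integral_series).
Proof. exact: asboolP. Qed.

Lemma pcoef0M f g : f \in integral_series -> g \in integral_series ->
  pcoef (f * g) 0 = pcoef f 0 * pcoef g 0.
Proof.
move=> /integral_seriesP hf /integral_seriesP hg.
rewrite (@pcoefM_single _ _ _ 0) ?subr0 // => a a0.
case: (ltrP a 0) => [/hf -> | a_ge0]; first by rewrite mul0r.
by rewrite hg ?mulr0 // sub0r oppr_lt0 lt_neqAle eq_sym a0.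
Qed.

Lemma integral_series_subring : subring_closed integral_series.
Proof.
split.
- by apply/integral_seriesP => r r0; rewrite pcoef_one lt_eqF.
- move=> f g /integral_seriesP hf /integral_seriesP hg; apply/integral_seriesP => r r0.
  by rewrite pcoefD pcoefN hf // hg // subr0.
- move=> f g /integral_seriesP hf /integral_seriesP hg; apply/integral_seriesP => r r0.
  rewrite (@pcoefM_single _ _ _ r) => [|a _]; first by rewrite hf // mul0r.
  case: (ltrP a 0) => [/hf -> | a_ge0]; first by rewrite mul0r.
  by rewrite hg ?mulr0 // subr_lt0 (lt_le_trans r0).
Qed.

HB.instance Definition _ := GRing.isSubringClosed.Build L integral_series
  integral_series_subring.

Record vring := VRing { vring_val : L; _ : vring_val \in integral_series }.

HB.instance Definition _ := [isSub for vring_val].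
HB.instance Definition _ := [Choice of vring by <:].
HB.instance Definition _ := [SubChoice_isSubComNzRing of vring by <:].

Lemma vring_domain (x y : vring) : x * y = 0 -> x = 0 \/ y = 0.
Proof.
move/(congr1 val); rewrite rmorphM rmorph0 => /eqP; rewrite mulf_eq0.
by case/orP => /eqP h; [left | right]; apply: val_inj; rewrite h rmorph0.
Qed.

Definition residue (x : vring) : C := pcoef (val x) 0.

Fact residue_is_additive : zmod_morphism residue.
Proof. by move=> x y; rewrite /residue rmorphB. Qed.
Fact residue_is_multiplicative : monoid_morphism residue.
Proof.
split; first by rewrite /residue rmorph1 pcoef_one eqxx.
by move=> x y; rewrite /residue rmorphM pcoef0M ?(valP x) ?(valP y).
Qed.
HB.instance Definition _ := GRing.isZmodMorphism.Build vring C residue residue_is_additive.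
HB.instance Definition _ := GRing.isMonoidMorphism.Build vring C residue residue_is_multiplicative.

Lemma pmonom_neq0 (r : rat) : pmonom 1 r != 0 :> L.
Proof.
apply/eqP => /(congr1 (fun f => pcoef f r)) /eqP.
by rewrite pcoef_monom eqxx pcoef0 oner_eq0.
Qed.

(** Dividing 1/f by its leading power t^r leaves an integral series with nonzero
    residue; multiplying by f gives t^(-r), whose residue is nonzero only when
    r = 0. *)
Lemma integral_inv f : f \in integral_series -> pcoef f 0 != 0 ->
  f^-1 \in integral_series.
Proof.
move=> fi f0.
have fn0 : f != 0 by apply: contraNneq f0 => ->; rewrite pcoef0.
have [r [vr _ rmin]] : exists r, [/\ pcoef f^-1 r != 0, pval f^-1 = (ratr r)%:E &
    forall s, pcoef f^-1 s != 0 -> r <= s] by apply: pvalE; rewrite invr_eq0.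
pose g := pmonom 1 (- r) * f^-1.
have gE s : pcoef g s = pcoef f^-1 (s + r) by rewrite pcoef_monomM mul1r opprK.
have gi : g \in integral_series.
  apply/integral_seriesP => s s0; rewrite gE; apply/eqP; apply: contraTT s0 => /rmin.
  by rewrite lerDr -leNgt.
have : pcoef (f * g) 0 != 0 by rewrite pcoef0M // mulf_neq0 // gE add0r.
rewrite /g mulrCA divff // mulr1 pcoef_monom.
rewrite [0 == - r]eq_sym oppr_eq0; case: (eqVneq r 0) => [r0 _|_]; last by rewrite eqxx.
apply/integral_seriesP => s s0.
by apply/eqP; apply: contraTT s0 => /rmin; rewrite r0 -leNgt.
Qed.

Lemma vring_inv (x : vring) : residue x != 0 -> exists y : vring,
  val y = (val x)^-1 /\ residue y = (residue x)^-1.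
Proof.
move=> x0; have yi := integral_inv (valP x) x0; exists (VRing yi); split => //.
have xy : x * VRing yi = 1.
  apply: val_inj; rewrite rmorphM rmorph1 /= divff //.
  by apply: contraNneq x0 => h; rewrite [residue x](_ : _ = pcoef (vring_val x) 0) // h pcoef0.
by apply: (mulfI x0); rewrite -rmorphM xy rmorph1 divff.
Qed.

(** The valuation of f / g is the difference of the valuations, seen after both
    are multiplied by the power of t that makes g a unit. *)
Lemma div_integral f g : g != 0 -> (pval g <= pval f)%E ->
  f / g \in integral_series /\ ((pval g < pval f)%E -> pcoef (f / g) 0 = 0).
Proof.
move=> g0 gf; have [r [gr gv rmin]] := pvalE g0.
pose T := pmonom 1 (- r) : L.
have TE h s : pcoef (T * h) s = pcoef h (s + r) by rewrite pcoef_monomM mul1r opprK.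
have -> : f / g = (T * f) * (T * g)^-1.
  by rewrite invfM mulrACA mulfV ?mul1r ?pmonom_neq0.
have gi : T * g \in integral_series.
  apply/integral_seriesP => s s0; rewrite TE; apply/eqP; apply: contraTT s0 => /rmin.
  by rewrite lerDr -leNgt.
have ginv : (T * g)^-1 \in integral_series.
  by apply: integral_inv => //; rewrite TE add0r.
have fs s : pcoef f s != 0 -> (pval f <= (ratr s)%:E)%E.
  by move=> h; apply: ereal_inf_lbound; exists s.
have fi : T * f \in integral_series.
  apply/integral_seriesP => s s0; rewrite TE; apply/eqP; apply: contraTT s0 => /fs h.
  have := le_trans gf h; rewrite gv lee_fin ler_rat lerDr.
  by rewrite -leNgt.
split; first exact: rpredM.
move=> lt; rewrite pcoef0M // TE add0r (_ : pcoef f r = 0) ?mul0r //.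
apply/eqP; apply: contraTT lt => /fs h; rewrite -leNgt.
by rewrite gv.
Qed.

Lemma pval_unit f : f \in integral_series -> pcoef f 0 != 0 -> pval f = 0%E.
Proof.
move=> /integral_seriesP fi f0.
have fn0 : f != 0 by apply: contraNneq f0 => ->; rewrite pcoef0.
have [r [fr -> rmin]] := pvalE fn0; congr (_%:E).
suff -> : r = 0 by rewrite raddf0.
apply/eqP; rewrite eq_le rmin //= leNgt.
by apply: contra fr => /fi ->.
Qed.

Lemma pconst_integral a : pconst a \in integral_series.
Proof. by apply/integral_seriesP => r r0; rewrite pcoef_monom lt_eqF. Qed.

Lemma pt_integral : pt R \in integral_series.
Proof.
apply/integral_seriesP => r r0; rewrite pcoef_monom lt_eqF //.
exact: lt_trans ltr01.
Qed.

End ValuationRing.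

(** * Laurent polynomials and polynomials over the valuation ring *)

Section LaurentTerms.
Variables (L : comNzRingType) (M : nat).
Local Notation A := {laurent L[M]}.
Implicit Types (f : A) (u v : 'rV[int]_M).

Lemma lcoef0 u : lcoef u (0 : A) = 0.
Proof. exact: monalg.mcoeff0. Qed.

Lemma lcoefD u f f' : lcoef u (f + f') = lcoef u f + lcoef u f'.
Proof. exact: monalg.mcoeffD. Qed.

Lemma lcoefZ u c f : lcoef u (c *: f) = c * lcoef u f.
Proof. exact: monalg.mcoeffZ. Qed.

Lemma lcoef_sum u (I : Type) (s : seq I) (P : pred I) (F : I -> A) :
  lcoef u (\sum_(i <- s | P i) F i) = \sum_(i <- s | P i) lcoef u (F i).
Proof. exact: (big_morph (lcoef u) (lcoefD u) (lcoef0 u)). Qed.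

Lemma lcoef_term u v (c : L) : lcoef v (lterm u c) = if u == v then c else 0.
Proof. by rewrite /lterm monalg.mcoeffU; case: eqP. Qed.

Lemma ltermM u v (c c' : L) : lterm u c * lterm v c' = lterm (u + v) (c * c').
Proof. exact: lmulUU. Qed.

Lemma ltermZ u (c c' : L) : c *: lterm u c' = lterm u (c * c').
Proof.
apply/monalg.malgP => v.
transitivity (c * lcoef v (lterm u c')); first exact: lcoefZ.
transitivity (c * (if u == v then c' else 0)).
  by congr (_ * _); exact: lcoef_term.
transitivity (if u == v then c * c' else 0); last by symmetry; exact: lcoef_term.
by case: (u == v); last exact: mulr0.
Qed.

Lemma lterm_prod (I : Type) (s : seq I) (P : pred I) (F : I -> 'rV[int]_M) :
  \prod_(i <- s | P i) lterm (F i) (1 : L) = lterm (\sum_(i <- s | P i) F i) 1.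
Proof.
elim/big_rec2: _ => [//|i u y _ ->].
by rewrite ltermM mul1r.
Qed.

Definition expo (m : multinom M) : 'rV[int]_M := \row_i (m i)%:Z.

Lemma expo_inj : injective expo.
Proof.
move=> m m' /rowP eqm; apply/mnmP => i; have := eqm i.
by rewrite !mxE => -[].
Qed.

Lemma lvar_monomial (m : multinom M) : \prod_i lvar L i ^+ m i = lterm (expo m) 1.
Proof.
have lvarX (i : 'I_M) k : lvar L i ^+ k = lterm (delta_mx 0 i *+ k) 1.
  elim: k => [//|k IH]; rewrite exprS IH /lvar. rewrite ltermM mul1r mulrS.
  by [].
under eq_bigr do rewrite lvarX.
rewrite lterm_prod; congr lterm; apply/rowP => j; rewrite summxE (bigD1 j) //=.
rewrite big1 => [|i ij]; rewrite mulmxnE !mxE ?eqxx /=.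
  by rewrite addr0; exact: natz.
by rewrite eq_sym (negbTE ij) mul0rn.
Qed.

End LaurentTerms.

Section Clearing.
Variables (R : realType) (M : nat).
Local Notation L := (puiseux R).
Local Notation O := (vring R).
Local Notation A := {laurent L[M]}.
Implicit Types (f h : A) (u v : 'rV[int]_M).

Definition scalar_incl : O -> A := in_alg A \o (val : O -> L).
HB.instance Definition _ := GRing.RMorphism.on scalar_incl.

(** The inclusion of O[x] in the Laurent polynomials over the field of fractions. *)
Definition iota : {mpoly O[M]} -> A := mmap scalar_incl (@lvar L M).
HB.instance Definition _ := GRing.RMorphism.on iota.

Lemma iotaE (P : {mpoly O[M]}) :
  iota P = \sum_(m <- mpoly.msupp P) lterm (expo m) (val (P@_m)).
Proof.
apply: eq_bigr => m _; rewrite /mmap1 lvar_monomial /scalar_incl /=.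
by rewrite -scalerAl mul1r ltermZ mulr1.
Qed.

Lemma iotaZ (s : O) (P : {mpoly O[M]}) : iota (s *: P) = val s *: iota P.
Proof. by rewrite /iota mmapZ /scalar_incl /= -scalerAl mul1r. Qed.

Lemma iotaX m : iota (mpolyX O m) = lterm (expo m) 1.
Proof. by rewrite iotaE msuppX big_seq1 mcoeffX eqxx rmorph1. Qed.

Lemma lcoef_iota (P : {mpoly O[M]}) m : lcoef (expo m) (iota P) = val (P@_m).
Proof.
rewrite iotaE lcoef_sum; case: (boolP (m \in mpoly.msupp P)) => mP.
  rewrite (bigD1_seq m) ?msupp_uniq //= lcoef_term eqxx big1 ?addr0 // => m' mm'.
  by rewrite lcoef_term (inj_eq (@expo_inj M)) (negbTE mm').
rewrite (memN_msupp_eq0 mP) rmorph0 big_seq big1 // => m' m'P.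
rewrite lcoef_term (inj_eq (@expo_inj M)); case: eqP => // mm'.
by rewrite -mm' m'P in mP.
Qed.

Lemma iota_inj : injective iota.
Proof.
move=> P Q PQ; apply/mpolyP => m; apply: val_inj.
by rewrite -!lcoef_iota PQ.
Qed.

Definition all_shift (e : nat) : multinom M := Multinom [tuple e | _ < M].

Definition shift_exp (e : nat) u : multinom M :=
  Multinom [tuple absz (u 0 i + e%:Z) | i < M].

Definition int_coef f u : O := insubd 0 (lcoef u f).

(** The polynomial (x_1 ... x_M)^e f; this needs the coefficients of f to be in the
    valuation ring, as [int_coef] is 0 on the others, and e to be so large that
    [absz] changes no sign. *)
Definition cleared (e : nat) f : {mpoly O[M]} :=
  \sum_(u <- lsupp f) int_coef f u *: mpolyX O (shift_exp e u).

Definition lintegral f := forall u, lcoef u f \in @integral_series R.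
Definition exp_bound (e : nat) f := forall u, u \in lsupp f -> forall i, 0 <= u 0 i + e%:Z.

Lemma iota_cleared e f : lintegral f -> exp_bound e f ->
  iota (cleared e f) = lterm (expo (all_shift e)) 1 * f.
Proof.
move=> fi fe; rewrite /cleared rmorph_sum [X in _ * X]laurentE mulr_sumr.
rewrite big_seq [RHS]big_seq; apply: eq_bigr => u /fe ue /=.
rewrite iotaZ iotaX ltermZ ltermM mulr1 mul1r /int_coef insubdK; last exact: fi.
congr lterm; apply/rowP => i; rewrite !mxE /shift_exp /all_shift.
by rewrite !multinomE !tnth_mktuple gez0_abs // addrC.
Qed.

(** The value at x0 of the residue of f. *)
Definition lres (x0 : 'I_M -> R[i]) f : R[i] :=
  \sum_(u <- lsupp f) pcoef (lcoef u f) 0 * \prod_i x0 i ^ (u 0 i).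

Lemma eval_cleared e f (x0 : 'I_M -> R[i]) : (forall i, x0 i != 0) ->
  lintegral f -> exp_bound e f ->
  mmap (@residue R) x0 (cleared e f) = lres x0 f * \prod_i x0 i ^+ e.
Proof.
move=> x00 fi fe; rewrite /cleared raddf_sum /lres mulr_suml.
rewrite big_seq [RHS]big_seq; apply: eq_bigr => u /fe ue /=.
rewrite mmapZ mmapX /mmap1 -mulrA -big_split /=; congr (_ * _).
  by rewrite /residue insubdK //; exact: fi.
apply: eq_bigr => i _; rewrite /shift_exp multinomE tnth_mktuple.
by rewrite !exprnP gez0_abs // expfzDr.
Qed.

Lemma exp_bound_ex f : exists e, exp_bound e f.
Proof.
exists (\sum_(u <- lsupp f) \sum_i absz (u 0%R i))%N => u uf i.
have : (absz (u 0%R i) <= \sum_(u <- lsupp f) \sum_i absz (u 0%R i))%N.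
  rewrite (big_rem u) //= (bigD1 i) //= -addnA; exact: leq_addr.
lia.
Qed.

Lemma exp_boundW e e' f : (e <= e')%N -> exp_bound e f -> exp_bound e' f.
Proof. by move=> ee' h u uf i; have := h u uf i; lia. Qed.

Lemma clear_denominator (c : L) : exists2 s : O, s != 0 & val s * c \in @integral_series R.
Proof.
case: (eqVneq c 0) => [->|c0]; first by exists 1; rewrite ?oner_neq0 // mulr0 rpred0.
have [r [cr _ rmin]] := pvalE c0.
case: (leP 0 r) => r0.
  exists 1; rewrite ?oner_neq0 // rmorph1 mul1r; apply/integral_seriesP => a a0.
  by apply/eqP; apply: contraTT a0 => /rmin ra; rewrite -leNgt (le_trans r0).
have ti : (pmonom 1 (- r) : L) \in @integral_series R.
  apply/integral_seriesP => a a0; rewrite pcoef_monom; case: eqP => // ar.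
  by move: a0; rewrite ar oppr_lt0 ltNge (ltW r0).
exists (VRing ti).
  by apply/eqP => /(congr1 val) /eqP; rewrite rmorph0 /= (negbTE (pmonom_neq0 _ _)).
apply/integral_seriesP => a a0; rewrite pcoef_monomM mul1r opprK.
by apply/eqP; apply: contraTT a0 => /rmin; rewrite lerDr -leNgt.
Qed.

Lemma clear_denominators f : exists2 s : O, s != 0 & lintegral (val s *: f).
Proof.
have [s s0 sf] : exists2 s : O, s != 0 &
    {in (lsupp f : seq _), forall u, val s * lcoef u f \in @integral_series R}.
  elim: (lsupp f : seq _) => [|u us [s s0 IH]]; first by exists 1; rewrite ?oner_neq0.
  have [s' s'0 s'u] := clear_denominator (lcoef u f).
  exists (s * s').
    by apply/eqP => /(@vring_domain R)[] /eqP; rewrite ?(negbTE s0) ?(negbTE s'0).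
  move=> v; rewrite inE rmorphM => /orP[/eqP ->|/IH sv].
    by rewrite -mulrA rpredM // (valP s).
  by rewrite mulrAC rpredM // (valP s').
exists s => // u; rewrite lcoefZ; case: (boolP (u \in lsupp f)) => [/sf //|uf].
by rewrite monalg.mcoeff_outdom // mulr0 rpred0.
Qed.

End Clearing.

(** * The equations over the valuation ring *)

Section ResidueOfIdeal.
Variables (R : realType) (M : nat).
Local Notation L := (puiseux R).
Local Notation O := (vring R).
Local Notation A := {laurent L[M]}.
Variables (c : 'I_M -> O) (d : nat -> R[i]) (g : nat -> {mpoly O[M]}).
Hypothesis c_neq0 : forall i, residue (c i) != 0.
Hypothesis g_deg : forall k, (k < M)%N -> deg_le k.+1 (g k.+1).
Hypothesis res_g : forall k, (k < M)%N -> map_mpoly (@residue R) (g k.+1) =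
  Defs.esym k.+1 (fun i => residue (c i) *: mvar i) - mpolyC M (d k.+1).

(** Clearing the denominators of the a i, both in t and in the variables, turns
    the relation into one of O[x] for a nonzero multiple of f. *)
Lemma lres_eq0 (x0 : 'I_M -> R[i]) (f : A) N (a : 'I_N -> A) (k : 'I_N -> 'I_M) :
  (forall i, x0 i != 0) ->
  (forall j, (j < M)%N -> mmap (@residue R) x0 (g j.+1) = 0) ->
  lintegral f -> f = \sum_i a i * iota (g (k i).+1) -> lres x0 f = 0.
Proof.
move=> x00 gx0 fi fE.
(* One denominator in t for all the a i, the product of the individual ones. *)
have [s s0 sa] : exists2 s : O, s != 0 & forall i, lintegral (val s *: a i).
  have [t t0 ta] := @fin_all_exists2 _ (fun=> O) (fun i t => t != 0)
    (fun i t => lintegral (val t *: a i)) (fun i => clear_denominators (a i)).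
  exists (\prod_i t i) => [|i u].
    elim/big_ind: _ => //; first exact: oner_neq0.
    by move=> x y x_neq0 y_neq0; apply/eqP => /(@vring_domain R)[] /eqP;
      rewrite ?(negbTE x_neq0) ?(negbTE y_neq0).
  rewrite (bigD1 i) //=; set T := \prod_(_ < _ | _) _.
  have -> : val (t i * T) *: a i = val T *: (val (t i) *: a i).
    by rewrite rmorphM mulrC scalerA.
  by rewrite lcoefZ rpredM ?(valP T) //; exact: ta.
have [e ef ea] : exists2 e, exp_bound e f & forall i, exp_bound e (val s *: a i).
  have [e0 e0f] := exp_bound_ex f.
  have [t ta] := @fin_all_exists _ (fun=> nat) (fun i t => exp_bound t (val s *: a i))
    (fun i => exp_bound_ex (val s *: a i)).
  exists (maxn e0 (\max_i t i)) => [|i]; first exact: exp_boundW (leq_maxl _ _) e0f.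
  apply: exp_boundW (ta i); apply: leq_trans (leq_maxr _ _); exact: (leq_bigmax i).
have sF : s *: cleared e f = \sum_i cleared e (val s *: a i) * g (k i).+1.
  apply: iota_inj; rewrite iotaZ iota_cleared // fE mulr_sumr scaler_sumr rmorph_sum.
  apply: eq_bigr => i _; rewrite rmorphM /= iota_cleared //.
  by rewrite -scalerAr -scalerAl mulrA.
have := deformation_saturation (@vring_domain R) c_neq0 g_deg res_g gx0 s0 sF.
move/eqP; rewrite eval_cleared // mulf_eq0 => /orP[/eqP //|].
by rewrite prodf_seq_eq0 => /hasP[i _]; rewrite /= expf_eq0 (negbTE (x00 i)) andbF.
Qed.

End ResidueOfIdeal.

Lemma esym_scale (K : comNzRingType) (A : comAlgType K) M k (w : 'I_M -> K) (v : 'I_M -> A) :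
  Defs.esym k (fun i => w i *: v i) =
  \sum_(S : {set 'I_M} | #|S| == k) (\prod_(i in S) w i) *: \prod_(i in S) v i.
Proof. by apply: eq_bigr => S _; rewrite scaler_prod. Qed.

Lemma esym_scale_sub (K : comNzRingType) (A : comAlgType K) M k (a b : K)
    (w w' : 'I_M -> K) (v : 'I_M -> A) :
  a *: Defs.esym k (fun i => w i *: v i) - b *: Defs.esym k (fun i => w' i *: v i) =
  \sum_(S : {set 'I_M} | #|S| == k)
    (a * (\prod_(i in S) w i) - b * \prod_(i in S) w' i) *: \prod_(i in S) v i.
Proof.
rewrite !esym_scale !scaler_sumr -sumrB; apply: eq_bigr => S _.
by rewrite !scalerA scalerBl.
Qed.

Section Expansion.
Variables (R : realType) (q : R[i]) (m n : nat) (d : nat -> R[i]).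
Hypothesis q_neq0 : q != 0.
Local Notation L := (puiseux R).
Local Notation O := (vring R).
Local Notation M := (m + n)%N.
Local Notation A := {laurent L[M]}.

Definition vringC (a : R[i]) : O := VRing (pconst_integral a).
Definition vringt : O := VRing (pt_integral R).

Lemma residue_vringC a : residue (vringC a) = a.
Proof. by transitivity (pcoef (pmonom a 0) 0) => //; rewrite pcoef_monom eqxx. Qed.

Lemma residue_vringt : residue vringt = 0.
Proof. by transitivity (pcoef (pmonom (1 : R[i]) 1) 0) => //; rewrite pcoef_monom. Qed.

Lemma pconstV : (pconst q)^-1 = pconst q^-1 :> L.
Proof.
have qq : pconst q * pconst q^-1 = 1 :> L.
  apply: puiseuxP => r; rewrite pcoef_monomM pcoef_monom pcoef_one subr0.
  by case: eqP => _; rewrite ?mulr0 // divff.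
have Q0 : pconst q != 0 :> L.
  by apply: contra_eq_neq qq => ->; rewrite mul0r eq_sym oner_neq0.
by apply: (mulfI Q0); rewrite qq divff.
Qed.

Definition qden : O := vringC q ^+ m - vringt * vringC q ^+ n.

Lemma residue_qden : residue qden = q ^+ m.
Proof.
by rewrite /qden rmorphB rmorphM /= residue_vringt mul0r subr0 rmorphXn /= residue_vringC.
Qed.

(** The factors by which the variables are multiplied in the two elementary
    symmetric polynomials of g_k. *)
Definition xscale (i : 'I_M) : O :=
  match fintype.split i with inl _ => vringC q^-1 | inr _ => 1 end.
Definition yscale (i : 'I_M) : O :=
  match fintype.split i with inl _ => 1 | inr _ => vringC q^-1 end.

Lemma residue_xscale_neq0 i : residue (xscale i) != 0.
Proof.
rewrite /xscale; case: fintype.split => _; last by rewrite rmorph1 oner_neq0.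
by rewrite residue_vringC invr_eq0.
Qed.

(** The second elementary symmetric polynomial is multiplied by t, so only the
    first one contributes to the residue. *)
Lemma gQQ_expansion : exists2 c : {set 'I_M} -> O,
  (forall S, residue (c S) = \prod_(i in S) residue (xscale i)) &
  (forall k, gQQ q m n d k =
    iota (\sum_(S : {set 'I_M} | #|S| == k) c S *: \prod_(i in S) mvar i
      - mpolyC M (vringC (d k)))).
Proof.
have den0 : residue qden != 0 by rewrite residue_qden expf_neq0.
have [E [EE resE]] := vring_inv den0.
pose c (S : {set 'I_M}) := vringC q ^+ m * E * (\prod_(i in S) xscale i)
   - vringt * vringC q ^+ n * E * \prod_(i in S) yscale i.
exists c => [S|k].
  rewrite /c rmorphB !rmorphM /= residue_vringt !mul0r subr0 rmorphXn /= residue_vringC.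
  by rewrite resE residue_qden divff ?expf_neq0 // mul1r rmorph_prod.
have varE (i : 'I_M) : lvar L i = match fintype.split i with
    inl j => xvar R n j | inr j => yvar R m j end.
  by rewrite -{1}(splitK i); case: fintype.split.
have jx : join_family (fun i => (pconst q)^-1 *: xvar R n i) (@yvar R m n) =
    (fun i => val (xscale i) *: lvar L i).
  apply/funext => i; rewrite varE /join_family /xscale pconstV.
  by case: fintype.split => j //; rewrite rmorph1 scale1r.
have jy : join_family (@xvar R m n) (fun j => (pconst q)^-1 *: yvar R m j) =
    (fun i => val (yscale i) *: lvar L i).
  apply/funext => i; rewrite varE /join_family /yscale pconstV.
  by case: fintype.split => j //; rewrite rmorph1 scale1r.
have iota_sum : iota (\sum_(S : {set 'I_M} | #|S| == k) c S *: \prod_(i in S) mvar i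
      - mpolyC M (vringC (d k))) =
    \sum_(S : {set 'I_M} | #|S| == k) val (c S) *: \prod_(i in S) lvar L i
      - (pconst (d k))%:A.
  rewrite rmorphB rmorph_sum /= [iota (mpolyC _ _)]mmapC; congr (_ - _).
  apply: eq_bigr => S _; rewrite iotaZ rmorph_prod; congr (_ *: _).
  by apply: eq_bigr => i _; rewrite /= /iota mmapX mmap1U.
have [a [b [gE val_c]]] : exists a b : L,
    gQQ q m n d k = a *: Defs.esym k (fun i => val (xscale i) *: lvar L i)
      - b *: Defs.esym k (fun i => val (yscale i) *: lvar L i) - (pconst (d k))%:A /\
    forall S, val (c S) =
      a * (\prod_(i in S) val (xscale i)) - b * \prod_(i in S) val (yscale i).
  exists (pconst q ^+ m / (pconst q ^+ m - pt R * pconst q ^+ n)).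
  exists (pt R * pconst q ^+ n / (pconst q ^+ m - pt R * pconst q ^+ n)).
  split=> [|S]; first by rewrite /gQQ jx jy.
  by rewrite /c rmorphB !rmorphM !rmorphXn !rmorph_prod /= EE /qden rmorphB rmorphM !rmorphXn.
have sumE : \sum_(S : {set 'I_M} | #|S| == k) val (c S) *: \prod_(i in S) lvar L i =
    \sum_(S : {set 'I_M} | #|S| == k) (a * (\prod_(i in S) val (xscale i))
      - b * \prod_(i in S) val (yscale i)) *: \prod_(i in S) lvar L i :> A.
  by apply: eq_bigr => S _; rewrite val_c.
have esymE := esym_scale_sub k a b (fun i => val (xscale i)) (fun i => val (yscale i))
  (fun i => lvar L i : A).
rewrite iota_sum gE sumE esymE; reflexivity.
Qed.

End Expansion.

(** * Tropical hypersurfaces *)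

Section BigMin.
Variables (R : realType) (I : eqType) (F : I -> \bar R).
Implicit Types (s : seq I).

Lemma bigmin_seq_le s i : i \in s ->
  (\big[Order.min/+oo]_(j <- s) F j <= F i)%E.
Proof.
elim: s => // j s IH; rewrite inE big_cons ge_min.
by move=> /orP[/eqP -> | /IH ->]; rewrite ?lexx ?orbT.
Qed.

Lemma bigmin_seq_attained s : s != [::] ->
  exists2 i, i \in s & (\big[Order.min/+oo]_(j <- s) F j)%E = F i.
Proof.
elim: s => // i [|j s] IH _.
  by exists i; rewrite ?inE // big_cons big_nil; apply: min_l; exact: leey.
have [k ks e] := IH isT; rewrite big_cons e.
case: (leP (F i) (F k)) => _; first by exists i; rewrite // inE eqxx.
by exists k; rewrite // inE ks orbT.
Qed.

End BigMin.

Section TropicalMinimum.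
Variables (R : realType) (M : nat).
Local Notation L := (puiseux R).
Local Notation A := {laurent L[M]}.
Implicit Types (f : A) (u v : 'rV[int]_M) (w : 'rV[R]_M).

Lemma trop_le f w u : u \in lsupp f -> (trop f w <= trop_term f w u)%E.
Proof. exact: bigmin_seq_le. Qed.

Lemma trop_attained f w : f != 0 ->
  exists2 u, u \in lsupp f & trop f w = trop_term f w u.
Proof.
move=> f0; apply: bigmin_seq_attained; apply: contraNneq f0 => s0.
by rewrite [f]laurentE s0 big_nil.
Qed.

(** A term that is alone in being minimal excludes w from the hypersurface. *)
Lemma trop_competitor f w u : trop_hypersurface f w -> u \in lsupp f ->
  exists v, [/\ v != u, v \in lsupp f & (trop_term f w v <= trop_term f w u)%E].
Proof.
move=> [-> | [v1 [v2 [v12 v1f v2f e1 e2]]]] uf; first by rewrite monalg.msupp0 in_fset0 in uf.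
case: (eqVneq v1 u) uf => [<- _ | v1u uf].
  by exists v2; rewrite eq_sym v12 e2 e1.
by exists v1; rewrite v1u e1 trop_le.
Qed.

(** If a single term had least valuation, dividing by its coefficient would leave
    that monomial as residue, which does not vanish at x0. *)
Lemma trop_hypersurface0 (x0 : 'I_M -> R[i]) f : (forall i, x0 i != 0) ->
  (forall c : L, lintegral (c *: f) -> lres x0 (c *: f) = 0) ->
  trop_hypersurface f 0.
Proof.
move=> x00 f_res; case: (eqVneq f 0) => [->|f0]; first by left.
have term0 v : trop_term f 0 v = pval (lcoef v f).
  by rewrite /trop_term big1 ?adde0 // => i _; rewrite mxE mulr0.
have [u uf umin] := trop_attained 0 f0.
right; apply: contrapT => unique.
have gt_u v : v \in lsupp f -> v != u -> (pval (lcoef u f) < pval (lcoef v f))%E.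
  move=> vf vu; rewrite -!term0 -umin lt_neqAle trop_le // andbT.
  by apply/eqP => e; apply: unique; exists v, u; rewrite vu vf uf -e -umin.
have cu0 : lcoef u f != 0 by rewrite monalg.mcoeff_neq0.
(* f' has coefficient 1 at u and coefficients of positive valuation elsewhere. *)
pose f' := (lcoef u f)^-1 *: f.
have coefE v : lcoef v f' = lcoef v f / lcoef u f by rewrite lcoefZ mulrC.
have f'i : lintegral f'.
  move=> v; rewrite coefE; case: (boolP (v \in lsupp f)) => vf; last first.
    by rewrite monalg.mcoeff_outdom // mul0r rpred0.
  apply: (div_integral cu0 _).1; case: (eqVneq v u) => [-> //|vu].
  exact/ltW/gt_u.
have := f_res _ f'i; rewrite /lres (bigD1_seq u) ?fset_uniq //=; last first.
  by rewrite -monalg.mcoeff_neq0 coefE divff ?oner_neq0.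
rewrite coefE divff // pcoef_one eqxx mul1r [X in _ + X]big_seq_cond.
rewrite [X in _ + X]big1 ?addr0 => [|v /andP[vf' vu]].
  move/eqP; rewrite prodf_seq_eq0 => /hasP[i _].
  by rewrite /= expfz_eq0 (negbTE (x00 i)) andbF.
have vf : v \in lsupp f.
  move: vf'; rewrite -!monalg.mcoeff_neq0 coefE; apply: contra => /eqP ->.
  by rewrite mul0r.
by rewrite coefE (div_integral cu0 (ltW (gt_u v vf vu))).2 ?mul0r // gt_u.
Qed.

End TropicalMinimum.

Section ElementarySupport.
Variables (R : realType) (M : nat).
Local Notation L := (puiseux R).
Local Notation A := {laurent L[M]}.
Implicit Types (S T : {set 'I_M}) (w : 'rV[R]_M).

Definition chi S : 'rV[int]_M := \row_i (i \in S)%:Z.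

Lemma chi_inj : injective chi.
Proof.
move=> S T /rowP eST; apply/finset.setP => i; have := eST i.
by rewrite !mxE; case: (_ \in S); case: (_ \in T).
Qed.

Lemma chi_eq0 S : (chi S == 0) = (S == finset.set0).
Proof.
have -> : 0 = chi finset.set0 by apply/rowP => i; rewrite !mxE finset.in_set0.
by rewrite (inj_eq chi_inj).
Qed.

Lemma lvar_prod S : \prod_(i in S) lvar L i = lterm (chi S) 1 :> A.
Proof.
rewrite lterm_prod; congr lterm; apply/rowP => j; rewrite summxE mxE.
case: (boolP (j \in S)) => jS.
  rewrite (bigD1 j) //= mxE !eqxx big1 ?addr0 // => i /andP[_ ij].
  by rewrite mxE eqxx eq_sym (negbTE ij).
by rewrite big1 // => i iS; rewrite mxE eqxx; case: eqP => // ji; rewrite ji iS in jS.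
Qed.

Variables (c : {set 'I_M} -> L) (d : nat -> L) (g : nat -> A).
Hypothesis c_unit : forall S, pval (c S) = 0%E /\ c S != 0.
Hypothesis d_unit : forall k, (0 < k <= M)%N -> pval (d k) = 0%E /\ d k != 0.
Hypothesis gE : forall k, (0 < k <= M)%N ->
  g k = \sum_(S : {set 'I_M} | #|S| == k) c S *: \prod_(i in S) lvar L i + (d k)%:A.

Lemma lcoef_g k u : (0 < k <= M)%N ->
  lcoef u (g k) = \sum_(S : {set 'I_M} | #|S| == k) (if chi S == u then c S else 0)
    + (if 0 == u then d k else 0).
Proof.
move=> kM; rewrite gE // lcoefD lcoef_sum; congr (_ + _).
  by apply: eq_bigr => S _; rewrite lvar_prod ltermZ mulr1 lcoef_term.
by rewrite (ltermZ (M := M) 0 (d k) 1) mulr1 lcoef_term.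
Qed.

Lemma chi_neq0 S : (0 < #|S|)%N -> chi S != 0.
Proof. by rewrite chi_eq0 -cards_eq0 -lt0n. Qed.

Lemma lcoef_g_chi S : (0 < #|S|)%N -> lcoef (chi S) (g #|S|) = c S.
Proof.
move=> S0; have SM : (0 < #|S| <= M)%N by rewrite S0 -[X in (_ <= X)%N]card_ord max_card.
rewrite lcoef_g // eq_sym (negbTE (chi_neq0 S0)) addr0 (bigD1 S) //= eqxx.
rewrite big1 ?addr0 // => T /andP[_ TS].
by rewrite (inj_eq chi_inj) (negbTE TS).
Qed.

Lemma lcoef_g_0 k : (0 < k <= M)%N -> lcoef 0 (g k) = d k.
Proof.
move=> kM; rewrite lcoef_g // eqxx big1 ?add0r // => S /eqP Sk.
by rewrite (negbTE (chi_neq0 _)) // Sk; case/andP: kM.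
Qed.

Lemma lsupp_g k u : (0 < k <= M)%N -> u \in lsupp (g k) ->
  u = 0 \/ exists2 S : {set 'I_M}, #|S| = k & u = chi S.
Proof.
move=> kM; rewrite -monalg.mcoeff_neq0 lcoef_g //; case: (eqVneq 0 u) => [<-|u0]; first by left.
rewrite addr0 => h; right; apply: contrapT => nex; case/eqP: h.
rewrite big1 // => S /eqP Sk; case: eqP => // uS; case: nex.
by exists S.
Qed.

Lemma trop_term_chi S w : (0 < #|S|)%N ->
  trop_term (g #|S|) w (chi S) = (\sum_(i in S) w 0 i)%:E.
Proof.
move=> S0; rewrite /trop_term lcoef_g_chi // (c_unit S).1 add0e; congr (_%:E).
rewrite [RHS]big_mkcond; apply: eq_bigr => i _; rewrite mxE.
by case: ifP => _; rewrite ?mul1r ?mul0r.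
Qed.

Lemma trop_term_0 k w : (0 < k <= M)%N -> trop_term (g k) w 0 = 0%E.
Proof.
move=> kM; rewrite /trop_term lcoef_g_0 // (d_unit kM).1 big1 ?adde0 // => i _.
by rewrite mxE mul0r.
Qed.

(** The constant term of g k has weight 0, the others have as weights the sums of k
    coordinates of w.  With k the number of negative coordinates, the sum of these
    is the strict minimum; when there are none, k = M leaves only the sum of all
    coordinates besides 0. *)
Lemma elementary_trop w :
  (forall k, (0 < k <= M)%N -> trop_hypersurface (g k) w) -> w = 0.
Proof.
move=> wg.
have w_ge0 i : 0 <= w 0 i.
  rewrite leNgt; apply/negP => wi; pose S := [set i | w 0 i < 0]%SET.
  have S0 : (0 < #|S|)%N by apply/card_gt0P; exists i; rewrite finset.inE.
  have SM : (0 < #|S| <= M)%N by rewrite S0 -[X in (_ <= X)%N]card_ord max_card.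
  have Sg : chi S \in lsupp (g #|S|).
    by rewrite -monalg.mcoeff_neq0 lcoef_g_chi // (c_unit S).2.
  have [v [vS vg]] := trop_competitor (wg _ SM) Sg.
  rewrite trop_term_chi //; have [-> | [T TS vT]] := lsupp_g SM vg.
    rewrite trop_term_0 // lee_fin leNgt (bigD1 i) ?finset.inE //= => /negP; apply.
    rewrite addrC; apply: ltr_wnDl => //; apply: sumr_le0 => j.
    by rewrite finset.inE => /andP[/ltW].
  rewrite vT -TS trop_term_chi ?TS // lee_fin => le_TS.
  have {}vS : T != S by apply: contraNneq vS => <-; rewrite vT.
  have [j jS jT] : exists2 j, j \in S & j \notin T.
    apply/subsetPn; apply: contra vS => ST; rewrite eq_sym.
    by rewrite eqEcard ST TS leqnn.
  move: le_TS; rewrite leNgt => /negP; apply.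
  rewrite (big_setID T) /= [ltRHS](big_setID S) /= finset.setIC; apply: ler_ltD => //.
  have jST : j \in S :\: T by rewrite finset.in_setD jT.
  rewrite (bigD1 j jST) /= addrC.
  apply: (@lt_le_trans _ _ 0); last first.
    by apply: sumr_ge0 => l; rewrite !finset.inE -leNgt => /andP[].
  apply: ltr_wnDl; last by move: jS; rewrite finset.inE.
  apply: sumr_le0 => l /andP[lST _]; have : l \in S :\: T := lST.
  by rewrite finset.in_setD finset.inE => /andP[_ /ltW].
apply/rowP => i; rewrite mxE; apply/eqP; rewrite eq_le w_ge0 andbT leNgt.
apply/negP => wi.
have MM : (0 < M <= M)%N by rewrite leqnn andbT (leq_ltn_trans _ (ltn_ord i)).
have g0 : 0 \in lsupp (g M) by rewrite -monalg.mcoeff_neq0 lcoef_g_0 // (d_unit MM).2.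
have [v [v0 vg]] := trop_competitor (wg _ MM) g0.
have [v0' | [T TM vT]] := lsupp_g MM vg; first by rewrite v0' eqxx in v0.
have M0 : (0 < M)%N by case/andP: MM.
have := trop_term_chi (S := T) w; rewrite TM trop_term_0 // vT => -> //.
rewrite lee_fin leNgt => /negP; apply.
have iT : i \in T.
  suff -> : T = finset.setT by rewrite finset.in_setT.
  by apply/eqP; rewrite eqEcard finset.subsetT cardsT card_ord TM leqnn.
rewrite (bigD1 i) //=; apply: ltr_wpDr => //.
by apply: sumr_ge0 => j _.
Qed.

End ElementarySupport.

(** * The main theorem *)

(** The z i are the opposites of the roots of Lambda. *)
Lemma esym_roots (K : closedFieldType) M (Lambda : {poly K}) (d : nat -> K) :
  Lambda = 'X^M + \sum_(1 <= k < M.+1) d k *: 'X^(M - k) ->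
  exists z : 'I_M -> K, forall k, (0 < k <= M)%N -> Defs.esym k z = d k.
Proof.
move=> LE; set r := \sum_(1 <= k < _) _ in LE.
have size_r : (size r < size ('X^M : {poly K}))%N.
  rewrite size_polyXn ltnS; apply: leq_trans (size_sum _ _ _) _.
  rewrite big_seq; apply/bigmax_leqP_seq => k; rewrite mem_index_iota => /andP[k1 kM] _.
  by apply: leq_trans (size_scale_leq _ _) _; rewrite size_polyXn; lia.
have lead1 : lead_coef Lambda = 1 by rewrite LE lead_coefDl // lead_coefXn.
have [s LambdaE] := closed_field_poly_normal Lambda.
rewrite lead1 scale1r in LambdaE.
have size_s : size s == M.
  have := size_prod_XsubC s id; rewrite -LambdaE LE size_polyDl // size_polyXn.
  by move=> [->].
pose t := Tuple size_s.
exists (fun i => - tnth t i) => k /andP[k1 kM].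
have := @mroots_coeff _ M t (Ordinal (kM : (k < M.+1)%N)).
rewrite /= -LambdaE LE coefD coefXn coef_sum (big_rem k) /=; last first.
  by rewrite mem_index_iota k1.
rewrite coefZ coefXn eqxx mulr1 (_ : (M - k == M)%N = false) ?add0r; last by lia.
rewrite big_seq big1 ?addr0 => [->|l]; last first.
  rewrite mem_rem_uniq ?iota_uniq // inE mem_index_iota => /andP[lk /andP[l1 lM]].
  by rewrite coefZ coefXn (_ : (M - k == M - l)%N = false) ?mulr0 //; lia.
rewrite /mesym raddf_sum mulr_sumr; apply: eq_bigr => S /eqP Sk.
rewrite prodrN Sk /= rmorph_prod /=; congr (_ * _).
by apply: eq_bigr => i _; rewrite mevalXU.
Qed.

Theorem theorem4p8 (R : realType) (q : R[i]) (hq : q != 0) (m n : nat)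
    (Lambda : {poly R[i]}) (d : nat -> R[i])
    (hLambda : Lambda = 'X^(m + n) +
       \sum_(1 <= k < (m + n).+1) d k *: 'X^(m + n - k))
    (hd : forall k, (1 <= k <= m + n)%N -> d k != 0) :
  [/\ tropical_basis (gQQ_set q m n d) (DefQQ q m n d),
      trop_variety (DefQQ q m n d) =
        \bigcap_(k in [set k | (1 <= k <= m + n)%N])
           trop_hypersurface (gQQ q m n d k) &
      trop_variety (DefQQ q m n d) = [set 0]].
Proof.
have [c res_c gQQE] := gQQ_expansion m n d hq.
pose M := (m + n)%N; pose sc := @xscale R q m n.
have sc0 i : residue (sc i) != 0 by exact: residue_xscale_neq0.
pose g k : {mpoly (vring R)[M]} :=
  \sum_(S : {set 'I_M} | #|S| == k) c S *: \prod_(i in S) mvar i - mpolyC M (vringC (d k)).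
have cap0 : \bigcap_(k in [set k | (1 <= k <= m + n)%N])
    trop_hypersurface (gQQ q m n d k) `<=` [set 0].
  move=> w wg.
  apply: (@elementary_trop _ _ (fun S => val (c S)) (fun k => - pconst (d k)) (gQQ q m n d)).
  - move=> S; have cS0 : residue (c S) != 0.
      by rewrite res_c; apply/prodf_neq0 => i _; exact: sc0.
    split; first by apply: pval_unit cS0; exact: valP.
    by apply: contraNneq cS0 => cS; rewrite /residue cS pcoef0.
  - move=> k /hd dk; have pd : pcoef (- pconst (d k)) 0 != 0.
      by rewrite pcoefN oppr_eq0 pcoef_monom eqxx.
    split; first by apply: pval_unit pd; rewrite rpredN; exact: pconst_integral.
    by apply: contraNneq pd => ->; rewrite pcoef0.
  - move=> k kM; rewrite gQQE rmorphB rmorph_sum /=; congr (_ + _).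
      apply: eq_bigr => S _; rewrite iotaZ rmorph_prod; congr (_ *: _).
      by apply: eq_bigr => i _; rewrite /= /iota mmapX mmap1U.
    by rewrite /iota mmapC scaleNr.
  - by move=> k kM; exact: wg.
have zero_in : [set 0] `<=` trop_variety (DefQQ q m n d).
  have [z ze] := esym_roots hLambda.
  pose x0 i := z i / residue (sc i).
  (* A zero coordinate would make the product e_M(z) of all the z_i vanish,
     but it equals d_M. *)
  have x00 i : x0 i != 0.
    rewrite mulf_neq0 ?invr_eq0 //.
    have MM : (0 < M <= M)%N by rewrite leqnn andbT (leq_ltn_trans _ (ltn_ord i)).
    have := hd _ MM; rewrite -(ze _ MM) /Defs.esym; apply: contraNneq => zi.
    rewrite big1 // => S /eqP SM; rewrite (bigD1 i) /= ?zi ?mul0r //.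
    suff -> : S = finset.setT by rewrite finset.in_setT.
    by apply/eqP; rewrite eqEcard finset.subsetT cardsT card_ord SM leqnn.
  have g_deg k : (k < M)%N -> deg_le k.+1 (g k.+1).
    move=> _; apply: deg_leD; last first.
      by rewrite /deg_le msizeN msizeC; case: eqP.
    apply: deg_le_sum => S /eqP <-; apply: deg_leZ.
    rewrite -sum1_card -[X in deg_le X _]big_enum -[X in deg_le _ X]big_enum /=.
    by apply: deg_le_prod => i; exact: deg_le_mvar.
  have res_g k : (k < M)%N -> map_mpoly (@residue R) (g k.+1) =
      Defs.esym k.+1 (fun i => residue (sc i) *: mvar i) - mpolyC M (d k.+1).
    move=> _; rewrite /g rmorphB rmorph_sum /= map_mpolyC /= residue_vringC esym_scale.
    congr (_ - _); apply: eq_bigr => S _; rewrite map_mpolyZ /= res_c rmorph_prod.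
    by congr (_ *: _); apply: eq_bigr => i _; rewrite /= map_mpolyX.
  have gx0 k : (k < M)%N -> mmap (@residue R) x0 (g k.+1) = 0.
    move=> kM; have kM' : (0 < k.+1 <= M)%N by [].
    rewrite rmorphB rmorph_sum /= mmapC /= residue_vringC -(ze _ kM').
    apply/eqP; rewrite subr_eq0; apply/eqP; apply: eq_bigr => S _.
    rewrite mmapZ /= res_c rmorph_prod -big_split; apply: eq_bigr => i _ /=.
    by rewrite mmapX mmap1U /x0 mulrC divfK.
  move=> _ -> f [N [a [b [gb ->]]]].
  have [k kE] : exists k : 'I_N -> 'I_M, forall i, b i = iota (g (k i).+1).
    apply: (@fin_all_exists _ (fun=> 'I_M) (fun i k => b i = iota (g k.+1))) => i.
    have [k /= /andP[k1 kM] <-] := gb i.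
    have kM' : (k.-1 < M)%N by rewrite prednK.
    by exists (Ordinal kM'); rewrite /= prednK // gQQE.
  (* The ideal contains the multiples of f by the scalars s. *)
  apply: (trop_hypersurface0 x00) => s fi.
  apply: (lres_eq0 sc0 g_deg res_g x00 gx0 fi (a := fun i => s *: a i) (k := k)).
  by rewrite scaler_sumr; apply: eq_bigr => i _; rewrite -scalerAl kE.
have sub_cap : trop_variety (DefQQ q m n d) `<=`
    \bigcap_(k in [set k | (1 <= k <= m + n)%N]) trop_hypersurface (gQQ q m n d k).
  move=> w wI k kM; apply: wI; exists 1%N, (fun=> 1), (fun=> gQQ q m n d k).
  by split; [move=> _; exists k | rewrite big_ord1 mul1r].
have capE : trop_variety (DefQQ q m n d) =
    \bigcap_(k in [set k | (1 <= k <= m + n)%N]) trop_hypersurface (gQQ q m n d k).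
  by apply/seteqP; split => // w /cap0; exact: zero_in.
split => //; last first.
  by apply/seteqP; split => // w /sub_cap /cap0.
split => //; last by rewrite capE bigcap_image.
apply: finite_image; apply: (sub_finite_set _ (finite_II (m + n).+1)).
by move=> k /andP[_ kM]; rewrite /= ltnS.
Qed.
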